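(* Let $(V,Y,\mathbf{1})$ be a nonlocal vertex algebra, let $F$ be a formal group over $\mathbb{C}$ with $f=\log F$, and let $\phi$ be an associate of the additive formal group $F_{\rm a}$. Set $$\bar{\phi}(x,z)=f^{-1}(\phi(f(x), f(z))),$$ an associate of $F$. Let $V_F=(V,Y_F,\mathbf{1})$ be the nonlocal vertex $F$-algebra with $Y_F(v,x)=Y(v,f(x))$. The map sending $(W,Y_{W})$ to $(W,Y_{W}^{f})$, where $Y_W^f(v,x)=Y_W(v,f(x))$, and sending each morphism $\theta$ to itself, is an isomorphism from the category of $\phi$-coordinated $V$-modules (resp. $\phi$-coordinated quasi $V$-modules) to the category of $\bar{\phi}$-coordinated $V_{F}$-modules (resp. $\bar{\phi}$-coordinated quasi $V_{F}$-modules).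
   Context: All vector spaces are over $\mathbb{C}$. A (one-dimensional) formal group over $\mathbb{C}$ is $F(x,y)\in\mathbb{C}[[x,y]]$ with $F(x,0)=x$, $F(0,y)=y$, $F(x,F(y,z))=F(F(x,y),z)$; it is automatically commutative. $F_{\rm a}(x,y)=x+y$. $\log F$ is the unique $f(x)\in\mathbb{C}[[x]]$ with $f(0)=0$, $f'(0)=1$, $f(F(x,y))=f(x)+f(y)$; $f^{-1}$ is its compositional inverse. An associate of $F$ is $\phi(x,z)\in\mathbb{C}((x))[[z]]$ with $\phi(x,0)=x$ and $\phi(\phi(x,y),z)=\phi(x,F(y,z))$; powers $\phi(x,z)^m$, $m\in\mathbb{Z}$, are taken in $\mathbb{C}((x))[[z]]$. A nonlocal vertex $F$-algebra is a vector space $V$ with a linear map $Y(\cdot,x):V\to \mathrm{Hom}(V,V((x)))$, $v\mapsto Y(v,x)=\sum_{n\in\mathbb{Z}}v_nx^{-n-1}$, and a vector $\mathbf{1}\in V$ such that $Y(\mathbf{1},x)v=v$, $Y(v,x)\mathbf{1}\in V[[x]]$, $\lim_{x\to0}Y(v,x)\mathbf{1}=v$ for $v\in V$, and for $u,v,w\in V$ there exists a nonnegative integer $l$ such that $$F(x_0,x_2)^lY(u,F(x_0,x_2))Y(v,x_2)w=F(x_0,x_2)^lY(Y(u,x_0)v,x_2)w,$$ where in $Y(u,F(x_0,x_2))$ the powers $F(x_0,x_2)^m$ are expanded in $\mathbb{C}((x_0))[[x_2]]$. A nonlocal vertex algebra is a nonlocal vertex $F_{\rm a}$-algebra. Substitution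 of $f(x)$ for $x$ uses $f(x)^m\in x^m\mathbb{C}[[x]]$ for $m\in\mathbb{Z}$. Let $V$ be a nonlocal vertex $F$-algebra and $\phi$ an associate of $F$. A $\phi$-coordinated quasi $V$-module is a vector space $W$ with a linear map $Y_W(\cdot,x):V\to\mathrm{Hom}(W,W((x)))$ such that $Y_W(\mathbf{1},x)=1_W$ and for $u,v\in V$ there exists $q(x_1,x_2)\in\mathbb{C}[[x_1,x_2]]$ such that $q(\phi(x_2,x_0),x_2)\neq0$, $q(x_1,x_2)Y_W(u,x_1)Y_W(v,x_2)\in\mathrm{Hom}(W,W((x_1,x_2)))$ and $$\left(q(x_1,x_2)Y_W(u,x_1)Y_W(v,x_2)\right)|_{x_1=\phi(x_2,x_0)}=q(\phi(x_2,x_0),x_2)Y_W(Y(u,x_0)v,x_2).$$ A $\phi$-coordinated $V$-module is defined in the same way with $q(x_1,x_2)$ required to be of the form $(x_1-x_2)^k$, $k$ a nonnegative integer. Here $W((x_1,x_2))=W[[x_1,x_2]][x_1^{-1},x_2^{-1}]$. A morphism $\theta:(W,Y_W)\to(W',Y_{W'})$ is a linear map with $\theta(Y_W(v,x)w)=Y_{W'}(v,x)\theta(w)$ for $v\in V$, $w\in W$. *)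

(* Defs.v *)
From mathcomp Require Import all_boot all_order all_algebra.
From mathcomp Require Import all_classical reals.
From mathcomp Require Export complex.

Set Implicit Arguments.
Unset Strict Implicit.
Unset Printing Implicit Defensive.

Import Order.TTheory GRing.Theory Num.Theory.
Local Open Scope ring_scope.

(* A formal series with coefficients in W is its coefficient
   function: [int -> W] in one variable, [int * int -> W] in two variables, the
   value at (m, n) being the coefficient of x^m z^n.  The sums
   [\sum_(i \in setT) _] are sums of finitely supported families (and 0 for
   other families); each one below is finitely supported for series lying in
   the stated spaces. *)

Section FormalSeries.
Variable K : fieldType.

(* W[[x]], W((x)), W[[x, z]], W((x, z)) and W((x))[[z]] *)
Definition power_series (W : lmodType K) : set (int -> W) :=
  fun a => forall n, n < 0 -> a n = 0.

Definition laurent_series (W : lmodType K) : set (int -> W) :=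
  fun a => exists N : int, forall n, n < N -> a n = 0.

Definition power_series2 (W : lmodType K) : set (int * int -> W) :=
  fun a => forall m n, m < 0 \/ n < 0 -> a (m, n) = 0.

Definition laurent_series2 (W : lmodType K) : set (int * int -> W) :=
  fun a => exists N : int, forall m n, m < N \/ n < N -> a (m, n) = 0.

Definition laurent_power (W : lmodType K) : set (int * int -> W) :=
  fun a => (forall m n, n < 0 -> a (m, n) = 0) /\
           (forall n, laurent_series (fun m => a (m, n))).

Definition smul (I : zmodType) (W : lmodType K) (a : I -> K) (b : I -> W) :
    I -> W :=
  fun i => \sum_(k \in [set: I]) a k *: b (i - k).

Definition smulK (I : zmodType) (a b : I -> K) : I -> K :=
  smul a (b : I -> K^o).

Definition monom (I : zmodType) (i : I) : I -> K := fun j => (j == i)%:R.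

Definition sone (I : zmodType) : I -> K := monom 0.

Definition sexpn (I : zmodType) (a : I -> K) (n : nat) : I -> K :=
  iter n (smulK a) (@sone I).

(* Inverse and integral powers of [a] in a ring D of series. *)
Definition sinv (I : zmodType) (D : set (I -> K)) (a : I -> K) : I -> K :=
  xget (fun=> 0) [set b | D b /\ smulK a b = @sone I].

Definition sexpz (I : zmodType) (D : set (I -> K)) (a : I -> K) (m : int) :
    I -> K :=
  match m with
  | Posz n => sexpn a n
  | Negz n => sexpn (sinv D a) n.+1
  end.

(* Powers in K((x)), and in K((x))[[z]]. *)
Definition pow1 (f : int -> K) (m : int) : int -> K :=
  sexpz (@laurent_series K^o) f m.

Definition pow2 (p : int * int -> K) (m : int) : int * int -> K :=
  sexpz (@laurent_power K^o) p m.

(* a(f(x)), for a(x) in W((x)) and f(x) in x K[[x]], f'(0) != 0 *)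
Definition subst1 (f : int -> K) (W : lmodType K) (a : int -> W) : int -> W :=
  fun n => \sum_(m \in [set: int]) pow1 f m n *: a m.

Definition subst1K (f a : int -> K) : int -> K := subst1 f (a : int -> K^o).

(* a(x1, x2) at x1 = phi(x2, x0); the coefficient of x2^m x0^n is at (m, n) *)
Definition subst_fst (phi : int * int -> K) (W : lmodType K)
    (a : int * int -> W) : int * int -> W :=
  fun p => \sum_(q \in [set: int * int])
    pow2 phi q.1 (p.1 - q.2, p.2) *: a q.

Definition subst_fstK (phi q : int * int -> K) : int * int -> K :=
  subst_fst phi (q : int * int -> K^o).

End FormalSeries.

Section FormalGroups.
Variable K : fieldType.
Implicit Types (F phi : int * int -> K) (f g : int -> K).

Definition Fadd : int * int -> K := fun p => monom K (1, 0) p + monom K (0, 1) p.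

(* The last clause compares the coefficients of x^a y^b z^c in
   F(x, F(y, z)) and F(F(x, y), z). *)
Definition formal_group F : Prop :=
  [/\ power_series2 (F : int * int -> K^o),
      (forall m, F (m, 0) = monom K 1 m),
      (forall n, F (0, n) = monom K 1 n) &
      forall a b c : int,
        \sum_(n \in [set: int]) F (a, n) * pow2 F n (b, c) =
        \sum_(n \in [set: int]) F (n, c) * pow2 F n (a, b)].

(* The last clause compares the coefficients of x^a y^b z^c in
   phi(phi(x, y), z) and phi(x, F(y, z)). *)
Definition associate F phi : Prop :=
  [/\ laurent_power (phi : int * int -> K^o),
      (forall m, phi (m, 0) = monom K 1 m) &
      forall a b c : int,
        \sum_(n \in [set: int]) phi (n, c) * pow2 phi n (a, b) =
        \sum_(n \in [set: int]) phi (a, n) * pow2 F n (b, c)].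

Definition is_log F f : Prop :=
  [/\ power_series (f : int -> K^o), f 0 = 0, f 1 = 1 &
      forall a b : int,
        \sum_(m \in [set: int]) f m * pow2 F m (a, b) =
        f a * (b == 0)%:R + (a == 0)%:R * f b].

Definition comp_inverse f g : Prop :=
  [/\ power_series (g : int -> K^o), g 0 = 0,
      subst1K f g = monom K 1 & subst1K g f = monom K 1].

(* phi(f(x), f(z)) *)
Definition subst_both f phi : int * int -> K :=
  fun p => \sum_(q \in [set: int * int])
    phi q * (pow1 f q.1 p.1 * pow1 f q.2 p.2).

(* g(phi(f(x), f(z))) *)
Definition conj_associate f g phi : int * int -> K :=
  fun p => \sum_(m \in [set: int]) g m * pow2 (subst_both f phi) m p.

End FormalGroups.

Section VertexAlgebras.
Variable K : fieldType.

(* [Y v w n] is the coefficient of x^n (not x^(-n-1)) in Y(v, x) w. *)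
Definition vertex_map (V W : lmodType K) (Y : V -> W -> int -> W) : Prop :=
  [/\ (forall w n, linear (fun v => Y v w n)),
      (forall v n, linear (fun w => Y v w n)) &
      (forall v w, laurent_series (Y v w))].

(* Y(u, x1) Y(v, x2) w, the coefficient of x1^m x2^n being at (m, n) *)
Definition Yprod (V W : lmodType K) (Y : V -> W -> int -> W) (u v : V) (w : W) :
    int * int -> W :=
  fun p => Y u (Y v w p.2) p.1.

(* Y(u, F(x0, x2)) Y(v, x2) w, powers of F being taken in K((x0))[[x2]];
   the coefficient of x0^m x2^n is at (m, n). *)
Definition Yprod_at (F : int * int -> K) (V W : lmodType K)
    (Y : V -> W -> int -> W) (u v : V) (w : W) : int * int -> W :=
  fun p => \sum_(q \in [set: int * int])
    pow2 F q.1 (p.1, p.2 - q.2) *: Yprod Y u v w q.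

Record nonlocal_vertex_algebra (F : int * int -> K) (V : lmodType K)
    (Y : V -> V -> int -> V) (vac : V) : Prop := NonlocalVertexAlgebra {
  nlva_map : vertex_map Y;
  nlva_vacl : forall v n, Y vac v n = if n == 0 then v else 0;
  nlva_vacr : forall v, power_series (Y v vac);
  nlva_creation : forall v, Y v vac 0 = v;
  nlva_assoc : forall u v w : V, exists l : nat,
    smul (sexpn F l) (Yprod_at F Y u v w) =
    smul (sexpn F l) (fun p => Y (Y u v p.1) w p.2)
}.

(* Y(v, f(x)) *)
Definition Ysubst (f : int -> K) (V W : lmodType K) (Y : V -> W -> int -> W) :
    V -> W -> int -> W :=
  fun v w => subst1 f (Y v w).

(* [Q] is the set of series in which q(x1, x2) is required to lie.  In the last
   equation the coefficient of x2^m x0^n is at (m, n). *)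
Record coordinated_module (Q : set (int * int -> K)) (phi : int * int -> K)
    (V : lmodType K) (Y : V -> V -> int -> V) (vac : V)
    (W : lmodType K) (YW : V -> W -> int -> W) : Prop := CoordinatedModule {
  cmod_map : vertex_map YW;
  cmod_vac : forall w n, YW vac w n = if n == 0 then w else 0;
  cmod_assoc : forall u v : V, exists q : int * int -> K,
    [/\ power_series2 (q : int * int -> K^o), Q q,
        subst_fstK phi q <> (fun=> 0),
        (forall w, laurent_series2 (smul q (Yprod YW u v w))) &
        forall w,
          subst_fst phi (smul q (Yprod YW u v w)) =
          smul (subst_fstK phi q) (fun p => YW (Y u v p.2) w p.1)]
}.

Definition all_series : set (int * int -> K) := setT.

(* the powers (x1 - x2)^k *)
Definition diff_powers : set (int * int -> K) :=
  fun q => exists k : nat,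
    q = sexpn (fun p => monom K (1, 0) p - monom K (0, 1) p) k.

Definition module_morphism (V W W' : lmodType K) (YW : V -> W -> int -> W)
    (YW' : V -> W' -> int -> W') (theta : W -> W') : Prop :=
  linear theta /\ forall v w n, theta (YW v w n) = YW' v (theta w) n.

End VertexAlgebras.

Arguments all_series {K}.
Arguments diff_powers {K}.

Record category := Category {
  obj :> Type;
  mor : obj -> obj -> Type;
  idm : forall A, mor A A;
  cmp : forall A B C, mor A B -> mor B C -> mor A C;
  cmp1m : forall A B (h : mor A B), cmp (idm A) h = h;
  cmpm1 : forall A B (h : mor A B), cmp h (idm B) = h;
  cmpA : forall A B C D (h : mor A B) (k : mor B C) (l : mor C D),
    cmp h (cmp k l) = cmp (cmp h k) l
}.

Record functor (C D : category) := Functor {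
  fobj :> C -> D;
  fmor : forall A B : C, mor A B -> mor (fobj A) (fobj B);
  fmor1 : forall A : C, fmor (idm A) = idm (fobj A);
  fmorM : forall (A B E : C) (h : mor A B) (k : mor B E),
    fmor (cmp h k) = cmp (fmor h) (fmor k)
}.

Definition functor_id (C : category) : functor C C :=
  @Functor C C id (fun _ _ => id) (fun=> erefl) (fun _ _ _ _ _ => erefl).

Program Definition functor_comp (C D E : category) (S : functor C D)
    (T : functor D E) : functor C E :=
  @Functor C E (fun A => T (S A)) (fun A B h => fmor T (fmor S h)) _ _.
Next Obligation. by move=> C D E S T A /=; rewrite !fmor1. Qed.
Next Obligation. by move=> C D E S T A B X h k /=; rewrite !fmorM. Qed.

Definition category_isomorphism (C D : category) (T : functor C D) : Prop :=
  exists S : functor D C,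
    functor_comp T S = functor_id C /\ functor_comp S T = functor_id D.

Section ModuleCategories.
Variables (K : fieldType) (Q : set (int * int -> K)).
Variables (V : lmodType K) (vac : V).

Record cmodule (phi : int * int -> K) (Y : V -> V -> int -> V) := CModule {
  cmod_space : lmodType K;
  cmod_Y : V -> cmod_space -> int -> cmod_space;
  cmod_axioms : coordinated_module Q phi Y vac cmod_Y
}.

Definition cmod_hom phi Y (M N : cmodule phi Y) : Type :=
  {theta : cmod_space M -> cmod_space N |
     module_morphism (@cmod_Y _ _ M) (@cmod_Y _ _ N) theta}.

Program Definition cmod_category phi Y : category :=
  @Category (cmodule phi Y) (@cmod_hom phi Y) (fun M => exist _ id _)
    (fun M N P h k => exist _ (sval k \o sval h) _) _ _ _.
Next Obligation. by []. Qed.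
Next Obligation.
move=> phi Y M N P [h [hl hY]] [k [kl kY]]; split=> /= [c w w'|v w n].
  by rewrite /= hl kl.
by rewrite /= hY kY.
Qed.
Next Obligation. by move=> phi Y M N [h hP]; exact: eq_exist. Qed.
Next Obligation. by move=> phi Y M N [h hP]; exact: eq_exist. Qed.
Next Obligation.
by move=> phi Y M N P S [h hP] [k kP] [l lP]; exact: eq_exist.
Qed.

Variables (f : int -> K) (phi phi' : int * int -> K).
Variables (Y Y' : V -> V -> int -> V).

Definition subst_preserves_modules : Prop :=
  forall (W : lmodType K) (YW : V -> W -> int -> W),
    coordinated_module Q phi Y vac YW ->
    coordinated_module Q phi' Y' vac (Ysubst f YW).

Definition subst_preserves_morphisms : Prop :=
  forall (M N : cmodule phi Y) (theta : cmod_space M -> cmod_space N),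
    module_morphism (@cmod_Y _ _ M) (@cmod_Y _ _ N) theta ->
    module_morphism (Ysubst f (@cmod_Y _ _ M)) (Ysubst f (@cmod_Y _ _ N)) theta.

(* (W, Y_W) |-> (W, Y_W(-, f(x))), theta |-> theta *)
Program Definition subst_functor (HO : subst_preserves_modules)
    (HM : subst_preserves_morphisms) :
    functor (cmod_category phi Y) (cmod_category phi' Y') :=
  @Functor (cmod_category phi Y) (cmod_category phi' Y')
    (fun M => CModule (HO _ _ (cmod_axioms M)))
    (fun M N h => exist _ (sval h) (HM _ _ _ (svalP h))) _ _.
Next Obligation. by move=> HO HM M; exact: eq_exist. Qed.
Next Obligation. by move=> HO HM M N P h k; exact: eq_exist. Qed.

Definition subst_isomorphism : Prop :=
  exists (HO : subst_preserves_modules) (HM : subst_preserves_morphisms),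
    category_isomorphism (subst_functor HO HM).

End ModuleCategories.

(* Main.v *)
(* Every substitution in the statement (f(x) for x, phi(x2, x0) for x1,
   F(x0, x2) for x0, and so on) is of the form a |-> \sum_m a_m r_m for a family
   (r_m) of series indexed by the exponents m of the substituted variables, with
   r_(k + l) = r_k r_l and r_0 = 1.  As in rings of Hahn series, each ring of
   series is given by the family of its possible supports; once (r_m) is
   summable with respect to such families, the substitution is multiplicative,
   and the composite of two substitutions is the substitution of the images of
   the r_m.

   Write T for the substitution of f(x), f(z) for x, z.  Then phibar = T(g(phi)),
   whence f(phibar)^m = T(phi^m) for all m in Z, and likewise F is the conjugate
   of F_a.  Hence T intertwines the substitutions x1 = phi(x2, x0) and
   x1 = phibar(x2, x0), and similarly for F_a and F; applying T to the axioms
   for (F_a, phi) gives those for (F, phibar).  For modules q(x1, x2) becomes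
   q(f(x1), f(x2)), which in the case of (x1 - x2)^k is divided by the k-th power
   of the unit (f(x1) - f(x2)) / (x1 - x2).  Exchanging f and g inverts the
   functor. *)
Require Import Defs.
From mathcomp Require Import all_boot all_order all_algebra.
From mathcomp Require Import all_classical reals.
From mathcomp Require Import zify.
From Stdlib Require Import JMeq.

Set Implicit Arguments.
Unset Strict Implicit.
Unset Printing Implicit Defensive.

Import Order.TTheory GRing.Theory Num.Theory.
Local Open Scope ring_scope.
Local Open Scope classical_set_scope.

(** * Finitely supported sums *)

(** A sum without finite support is 0 by convention, so no interchange of summations is valid until
    finiteness has been shown; hence the bookkeeping of supports. No single ring of series suffices:
    Y(u, x1) Y(v, x2) w lies only in W((x1))((x2)), the substitution x1 = phi(x2, x0) requires
    W((x1, x2)) and lands in W((x2))[[x0]], and the two sides of associativity over F lie in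
    W((x0))((x2)) and W((x2))((x0)). Powers phi^m occur for arbitrarily large m, while the orders in
    x of the coefficients of phi need not be bounded below; finiteness then rests on an estimate for
    phi^m that is uniform in m. In the algebra axiom the transformed multiplier (f(x0) + f(x2))^l is
    not F(x0, x2)^l, but F is a power series multiple of f(x0) + f(x2). Finally, an isomorphism
    rather than an equivalence of categories asks for equality of functors. *)

Lemma fsum_sub (W : nmodType) (I : choiceType) (A : set I) (F : I -> W) :
  (forall i, F i != 0 -> A i) ->
  \sum_(i \in [set: I]) F i = \sum_(i \in A) F i.
Proof.
move=> FA; apply/esym/fsbig_widen => // i [_ nA] /=.
by apply/eqP; apply: contra_notT nA => /FA.
Qed.

Lemma fsum1 (W : nmodType) (I : choiceType) (i : I) (F : I -> W) :
  (forall j, j != i -> F j = 0) -> \sum_(j \in [set: I]) F j = F i.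
Proof.
move=> F0; rewrite -[RHS](@fsbig_set1 W 0 +%R I i F); apply: fsum_sub => j.
by apply: contra_neqP => /eqP/F0.
Qed.

Section FiniteSums.
Variables (K : fieldType) (W : lmodType K).

(** No finiteness is assumed: for c nonzero both families have the same support, and if it is
    infinite both sums are 0 by convention. *)
Lemma fsum_scaler (I : choiceType) (c : K) (F : I -> W) :
  c *: (\sum_(i \in [set: I]) F i) = \sum_(i \in [set: I]) c *: F i.
Proof.
have [->|c0] := eqVneq c 0.
  by rewrite scale0r fsbig1 // => i _; rewrite scale0r.
have [fin|inf] := pselect (finite_set [set i | F i != 0]); last first.
  rewrite !fsbig_dflt ?scaler0 //; apply: contra_not inf;
    by apply: sub_finite_set => i /= Fi; split=> //=; apply/eqP;
       rewrite ?scaler_eq0 ?negb_or ?c0.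
rewrite !(@fsum_sub _ _ [set i | F i != 0]) //; last first.
  by move=> i /=; rewrite scaler_eq0 negb_or => /andP[].
by rewrite !fsbig_finite // scaler_sumr.
Qed.

Lemma fsum_pair (I J : choiceType) (F : I -> J -> W) :
  finite_set [set p : I * J | F p.1 p.2 != 0] ->
  \sum_(i \in [set: I]) \sum_(j \in [set: J]) F i j =
  \sum_(p \in [set: I * J]) F p.1 p.2.
Proof.
set S := [set p | _] => fin.
have F1 : finite_set S.`1 by exact: finite_set_fst.
have F2 : finite_set S.`2 by exact: finite_set_snd.
rewrite (@fsum_sub _ _ S.`1); last first.
  move=> i /(@fsbigN1 _ _ _ _ _ _ (fun i j => F i j)) [j _ Fij].
  by exists j.
have -> : \sum_(i \in S.`1) \sum_(j \in [set: J]) F i j =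
          \sum_(i \in S.`1) \sum_(j \in S.`2) F i j.
  by apply: eq_fsbigr => i _; apply: fsum_sub => j Fij; exists i.
rewrite pair_fsbig //; apply/esym/fsum_sub => -[i j] Fij.
by split; [exists j|exists i].
Qed.

Lemma fsum_swap (I J : choiceType) (F : I -> J -> W) :
  \sum_(p \in [set: I * J]) F p.1 p.2 = \sum_(p \in [set: J * I]) F p.2 p.1.
Proof.
by rewrite (@reindex_fsbigT _ _ _ _ _ (fun p : J * I => (p.2, p.1))) //;
   exists (fun p => (p.2, p.1)) => -[].
Qed.

Lemma fsum_exchange (I J : choiceType) (F : I -> J -> W) :
  finite_set [set p : I * J | F p.1 p.2 != 0] ->
  \sum_(i \in [set: I]) \sum_(j \in [set: J]) F i j =
  \sum_(j \in [set: J]) \sum_(i \in [set: I]) F i j.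
Proof.
move=> fin; rewrite fsum_pair // (fsum_pair (F := fun j i => F i j)) ?fsum_swap //.
apply: sub_finite_set (finite_image (fun p => (p.2, p.1)) fin).
by move=> [j i] /= Fij; exists (i, j).
Qed.

Lemma fsum_shift (I : zmodType) (d : I) (F : I -> W) :
  \sum_(i \in [set: I]) F i = \sum_(i \in [set: I]) F (i + d).
Proof.
rewrite (@reindex_fsbigT _ _ _ _ _ (fun i : I => i + d)) //.
by exists (fun i => i - d) => i; rewrite ?addrK ?subrK.
Qed.

Lemma fsum_opp (I : zmodType) (d : I) (F : I -> W) :
  \sum_(i \in [set: I]) F i = \sum_(i \in [set: I]) F (d - i).
Proof.
rewrite (@reindex_fsbigT _ _ _ _ _ (fun i : I => d - i)) //.
by exists (fun i => d - i) => i; rewrite subKr.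
Qed.

Lemma fsumD (I : choiceType) (F G : I -> W) :
  finite_set [set i | F i != 0] -> finite_set [set i | G i != 0] ->
  \sum_(i \in [set: I]) (F i + G i) =
  \sum_(i \in [set: I]) F i + \sum_(i \in [set: I]) G i.
Proof.
move=> finF finG; set A := [set i | F i != 0] `|` [set i | G i != 0].
have finA : finite_set A by rewrite finite_setU.
rewrite !(@fsum_sub _ _ A) ?fsbig_split //; first by move=> i; right.
  by move=> i; left.
move=> i; rewrite /A /=; apply: contraPP => /not_orP[/negP + /negP].
by rewrite !negbK => /eqP-> /eqP->; rewrite addr0 eqxx.
Qed.

Lemma fsum_linear (W' : lmodType K) (h : W -> W') (I : choiceType)
    (F : I -> W) :
  linear h -> finite_set [set i | F i != 0] ->
  h (\sum_(i \in [set: I]) F i) = \sum_(i \in [set: I]) h (F i).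
Proof.
move=> hl fin.
have hD x y : h (x + y) = h x + h y by have := hl 1 x y; rewrite !scale1r.
have h0 : h 0 = 0 by apply: (addrI (h 0)); rewrite -hD !addr0.
rewrite (@fsum_sub _ _ [set i | F i != 0]) //.
have -> : \sum_(i \in [set: I]) h (F i) =
          \sum_(i \in [set i | F i != 0]) h (F i).
  apply/esym/fsbig_widen => // i [_ /negP]; rewrite negbK => /eqP /= ->.
  exact: h0.
by rewrite !fsbig_finite // (big_morph h hD h0).
Qed.

Lemma fsum_mul (I J : choiceType) (u : I -> K) (v : J -> W) :
  finite_set [set i | u i != 0] -> finite_set [set j | v j != 0] ->
  (\sum_(i \in [set: I]) u i) *: (\sum_(j \in [set: J]) v j) =
  \sum_(p \in [set: I * J]) u p.1 *: v p.2.
Proof.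
move=> finu finv.
have fin : finite_set [set p : I * J | u p.1 *: v p.2 != 0].
  apply: sub_finite_set (finite_setX finu finv) => -[i j] /=.
  by rewrite scaler_eq0 negb_or => /andP[].
rewrite -(fsum_pair (F := fun i j => u i *: v j)) //.
under [RHS]eq_fsbigr do rewrite -fsum_scaler.
move: (\sum_(j \in [set: J]) v j) => w; set x := (X in X *: _).
rewrite /x (@fsum_sub _ _ [set i | u i != 0]) //.
rewrite [RHS](@fsum_sub _ _ [set i | u i != 0]); last first.
  by move=> i; rewrite scaler_eq0 negb_or => /andP[].
by rewrite !fsbig_finite // scaler_suml.
Qed.

End FiniteSums.

(** * Supports, products and general substitutions *)

Section Supports.
Variable K : fieldType.

Definition supp (I : zmodType) (W : lmodType K) (a : I -> W) : set I :=
  [set i | a i != 0].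

Definition sumset (I : zmodType) (S T : set I) : set I :=
  [set i | exists2 s, S s & T (i - s)].

Definition decomposable (I : zmodType) (S T : set I) : Prop :=
  forall i, finite_set [set s | S s /\ T (i - s)].

Lemma supp_smul (I : zmodType) (W : lmodType K) (a : I -> K) (b : I -> W) :
  supp (smul a b) `<=` sumset (supp (a : I -> K^o)) (supp b).
Proof.
move=> i /(@fsbigN1 _ _ _ _ _ _ (fun i k => a k *: b (i - k))) [k _].
by rewrite scaler_eq0 negb_or => /andP[? ?]; exists k.
Qed.

Lemma smulKC (I : zmodType) (a b : I -> K) : smulK a b = smulK b a.
Proof.
apply/funext => i; rewrite /smulK /smul (fsum_opp i).
by apply: eq_fsbigr => k _; rewrite subKr; exact: mulrC.
Qed.

Lemma smulKBl (I : zmodType) (a b c : I -> K) :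
  decomposable (supp (a : I -> K^o)) (supp (c : I -> K^o)) ->
  decomposable (supp (b : I -> K^o)) (supp (c : I -> K^o)) ->
  smulK (fun i => a i - b i) c = fun i => smulK a c i - smulK b c i.
Proof.
move=> dac dbc; apply/funext => i.
have -> : - smulK b c i = \sum_(k \in [set: I]) (- b k *: (c (i - k) : K^o)).
  rewrite -mulN1r [LHS]mulr_fsumr; apply: eq_fsbigr => k _.
  by rewrite mulN1r scaleNr.
apply: etrans (@fsumD K K^o _ (fun k => a k *: (c (i - k) : K^o))
                              (fun k => - b k *: (c (i - k) : K^o)) _ _).
- by apply: eq_fsbigr => k _; rewrite -scalerDl.
- by apply: sub_finite_set (dac i) => k /=; rewrite mulf_eq0 negb_or => /andP[].
- apply: sub_finite_set (dbc i) => k /=; rewrite scaleNr oppr_eq0.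
  by rewrite mulf_eq0 negb_or => /andP[].
Qed.

Lemma smul_monom (I : zmodType) (W : lmodType K) (d : I) (b : I -> W) (i : I) :
  smul (@monom K I d) b i = b (i - d).
Proof.
rewrite /smul (fsum1 (i := d)); first by rewrite /monom eqxx scale1r.
by move=> j /negPf jd; rewrite /monom jd scale0r.
Qed.

Lemma smul1 (I : zmodType) (W : lmodType K) (b : I -> W) :
  smul (@sone K I) b = b.
Proof. by apply/funext => i; rewrite /sone smul_monom subr0. Qed.

(** Both sides sum a_j b_(l-j) c_(i-l) over the pairs (l, j). Finitely many l arise from splitting i
    between A + B and the support of c, and for each of them finitely many j from splitting l
    between A and B. *)
Lemma smulKA (I : zmodType) (W : lmodType K) (a b : I -> K) (c : I -> W) :
  let A := supp (a : I -> K^o) in let B := supp (b : I -> K^o) in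
  decomposable A B -> decomposable (sumset A B) (supp c) ->
  smul (smulK a b) c = smul a (smul b c).
Proof.
move=> A B decAB decC; apply/funext => i; rewrite /smul.
have fin : finite_set [set p : I * I |
    a p.2 *: (b (p.1 - p.2) *: c (i - p.1)) != 0].
  apply: (@sub_finite_set _ _ (\bigcup_(l in [set l | sumset A B l /\
      supp c (i - l)]) ((pair l) @` [set j | A j /\ B (l - j)]))).
    move=> [l j] /=; rewrite !scaler_eq0 !negb_or => /and3P[aj bj cl].
    by exists l; [split=> //; exists j|exists j].
  by apply: bigcup_finite => [|l _]; [exact: decC|apply: finite_image].
transitivity (\sum_(l \in [set: I]) \sum_(j \in [set: I])
    a j *: (b (l - j) *: c (i - l))).
  apply: eq_fsbigr => l _; have [c0|c0] := eqVneq (c (i - l)) 0.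
    by rewrite c0 scaler0 fsbig1 // => j _; rewrite !scaler0.
  have fin' : finite_set [set j | a j * b (l - j) != 0].
    have [//|] := pselect (finite_set [set j | a j * b (l - j) != 0]).
    case; apply: sub_finite_set (finite_image snd fin) => j /= ab.
    exists (l, j) => //=; rewrite scalerA scaler_eq0 negb_or.
    by rewrite ab.
  rewrite /smulK /smul (@fsum_sub K^o _ [set j | a j * b (l - j) != 0]) //.
  rewrite [RHS](@fsum_sub _ _ [set j | a j * b (l - j) != 0]); last first.
    by move=> j /=; rewrite scalerA scaler_eq0 negb_or => /andP[].
  rewrite !fsbig_finite // scaler_suml.
  by apply: eq_bigr => j _; rewrite scalerA.
rewrite fsum_exchange //; apply: eq_fsbigr => j _.
rewrite fsum_scaler (fsum_shift j).
by apply: eq_fsbigr => k _; rewrite addrK opprD addrA addrAC.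
Qed.

Definition ssub (M : choiceType) (I : Type) (r : M -> I -> K) (W : lmodType K)
    (a : M -> W) : I -> W :=
  fun i => \sum_(m \in [set: M]) r m i *: a m.

Definition ssubK (M : choiceType) (I : Type) (r : M -> I -> K) (a : M -> K) :
    I -> K :=
  ssub r (a : M -> K^o).

(** This set and the next condition depend on the exponents in D only, so one verification serves
    coefficients in every space W. *)
Definition image_supp (M I : Type) (r : M -> I -> K) (D : set M) : set I :=
  [set i | exists2 m, D m & r m i != 0].

Definition locally_finite (M I : Type) (r : M -> I -> K) (D : set M) : Prop :=
  forall i, finite_set [set m | D m /\ r m i != 0].

Lemma supp_ssub (M : zmodType) (I : zmodType) (r : M -> I -> K) (W : lmodType K)
    (a : M -> W) : supp (ssub r a) `<=` image_supp r (supp a).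
Proof.
move=> i /(@fsbigN1 _ _ _ _ _ _ (fun i m => r m i *: a m)) [m _].
by rewrite scaler_eq0 negb_or => /andP[? ?]; exists m.
Qed.

(** Expanding r_(k+l) as a product turns both sides into the sum of r_k(j) r_l(i-j) a_k b_l over (j,
    (k, l)). The set [T] contains all nonzero terms and is finite: decomposability bounds j, and
    local finiteness then bounds k and l. Multiplicativity is asked on A and B only, because
    [geometric_inverse] uses a family that has it only for nonnegative exponents. *)
Lemma ssub_smul (M I : zmodType) (r : M -> I -> K) (W : lmodType K)
    (a : M -> K) (b : M -> W) (A B : set M) :
  supp (a : M -> K^o) `<=` A -> supp b `<=` B ->
  locally_finite r A -> locally_finite r B ->
  decomposable (image_supp r A) (image_supp r B) ->
  (forall k l, A k -> B l -> r (k + l) = smulK (r k) (r l)) ->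
  ssub r (smul a b) = smul (ssubK r a) (ssub r b).
Proof.
move=> aA bB lA lB dec rM; apply/funext => i.
pose T := \bigcup_(j in [set j | image_supp r A j /\ image_supp r B (i - j)])
  (pair j @` ([set k | A k /\ r k j != 0] `*` [set l | B l /\ r l (i - j) != 0])).
have finT : finite_set T.
  by apply: bigcup_finite => // j _; apply/finite_image/finite_setX.
have TP j k l : a k != 0 -> b l != 0 -> r k j != 0 -> r l (i - j) != 0 ->
    T (j, (k, l)).
  move=> /aA Ak /bB Bl rk rl; exists j; last by exists (k, l).
  by split; [exists k|exists l].
have fin1 : finite_set [set p : M * M | r (p.1 + p.2) i *: (a p.1 *: b p.2) != 0].
  apply: sub_finite_set (finite_image snd finT) => -[k l] /=.
  rewrite !scaler_eq0 !negb_or => /and3P[rkl ak bl].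
  move: rkl; rewrite rM; [|exact: aA|exact: bB].
  move=> /(@fsbigN1 _ _ _ _ _ _ (fun i j => r k j * r l (i - j))) [j _].
  rewrite mulf_eq0 negb_or => /andP[rk rl].
  by exists (j, (k, l)) => //; apply: TP.
have fin3 : finite_set [set p : I * (M * M) |
    (r p.2.1 p.1 * r p.2.2 (i - p.1)) *: (a p.2.1 *: b p.2.2) != 0].
  apply: sub_finite_set finT => -[j [k l]] /=.
  rewrite !scaler_eq0 mulf_eq0 !negb_or => /andP[/andP[rk rl] /andP[ak bl]].
  exact: TP.
transitivity (\sum_(p \in [set: M * M]) r (p.1 + p.2) i *: (a p.1 *: b p.2)).
  rewrite /ssub /smul; under eq_fsbigr do rewrite fsum_scaler.
  rewrite fsum_exchange.
    rewrite -(fsum_pair (F := fun k l => r (k + l) i *: (a k *: b l))) //.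
    apply: eq_fsbigr => k _; rewrite (fsum_shift k).
    by apply: eq_fsbigr => l _; rewrite addrK addrC.
  apply: sub_finite_set (finite_image (fun p => (p.1 + p.2, p.1)) fin1).
  move=> [m k] /= H; exists (k, m - k) => /=; rewrite addrC subrK //.
transitivity (\sum_(p \in [set: M * M]) \sum_(j \in [set: I])
    (r p.1 j * r p.2 (i - j)) *: (a p.1 *: b p.2)).
  apply: eq_fsbigr => -[k l] _ /=; have [ab0|ab0] := eqVneq (a k *: b l) 0.
    by rewrite ab0 scaler0 fsbig1 // => j _; rewrite scaler0.
  move: (ab0); rewrite scaler_eq0 negb_or => /andP[ak bl].
  rewrite rM; [|exact: aA|exact: bB].
  have fin : finite_set [set j | r k j * r l (i - j) != 0].
    apply: sub_finite_set (finite_image fst finT) => j /=.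
    rewrite mulf_eq0 negb_or => /andP[rk rl].
    by exists (j, (k, l)) => //; apply: TP.
  rewrite /smulK /smul (@fsum_sub K^o _ [set j | r k j * r l (i - j) != 0]) //.
  rewrite [RHS](@fsum_sub _ _ [set j | r k j * r l (i - j) != 0]); last first.
    by move=> j /=; rewrite scaler_eq0 negb_or => /andP[].
  by rewrite !fsbig_finite // scaler_suml.
rewrite -fsum_exchange //; apply: eq_fsbigr => j _.
have finu : finite_set [set k | r k j * a k != 0].
  apply: sub_finite_set (lA j) => k /=.
  by rewrite mulf_eq0 negb_or => /andP[rk /aA].
have finv : finite_set [set l | r l (i - j) *: b l != 0].
  apply: sub_finite_set (lB (i - j)) => k /=.
  by rewrite scaler_eq0 negb_or => /andP[rk /bB].
rewrite /ssubK /ssub (@fsum_mul _ _ _ _ (fun k => r k j * a k)) //.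
by apply: eq_fsbigr => -[k l] _ /=; rewrite !scalerA mulrAC.
Qed.

Lemma ssub_comp (M N I : choiceType) (s : M -> N -> K) (r : N -> I -> K)
    (W : lmodType K) (a : M -> W) (D : set M) :
  (forall m, a m != 0 -> D m) ->
  locally_finite s D -> locally_finite r (image_supp s D) ->
  ssub r (ssub s a) = ssub (fun m => ssubK r (s m)) a.
Proof.
move=> aD ls lr; apply/funext => i; rewrite /ssub.
pose T := \bigcup_(n in [set n | image_supp s D n /\ r n i != 0])
  (pair n @` [set m | D m /\ s m n != 0]).
have finT : finite_set T by apply: bigcup_finite => // n _; apply/finite_image.
have fin : finite_set [set p : N * M | r p.1 i *: (s p.2 p.1 *: a p.2) != 0].
  apply: sub_finite_set finT => -[n m] /=.
  rewrite !scaler_eq0 !negb_or => /and3P[rn sm /aD Dm].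
  by exists n; [split=> //; exists m|exists m].
under eq_fsbigr do rewrite fsum_scaler.
rewrite fsum_exchange //; apply: eq_fsbigr => m _.
have [a0|a0] := eqVneq (a m) 0.
  by rewrite a0 scaler0 fsbig1 // => n _; rewrite !scaler0.
have fin' : finite_set [set n | r n i * s m n != 0].
  apply: sub_finite_set (finite_image fst fin) => n /=.
  by exists (n, m) => //=; rewrite scalerA scaler_eq0 negb_or a0 andbT.
rewrite /ssubK /ssub (@fsum_sub K^o _ [set n | r n i * s m n != 0]) //.
rewrite [LHS](@fsum_sub _ _ [set n | r n i * s m n != 0]); last first.
  by move=> j /=; rewrite scalerA scaler_eq0 negb_or => /andP[].
rewrite !fsbig_finite // scaler_suml.
by apply: eq_bigr => n _; rewrite scalerA.
Qed.

Lemma ssub_linear (M : choiceType) (I : Type) (r : M -> I -> K)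
    (W : lmodType K) (c : K) (a b : M -> W) (i : I) :
  finite_set [set m | a m != 0 /\ r m i != 0] ->
  finite_set [set m | b m != 0 /\ r m i != 0] ->
  ssub r (fun m => c *: a m + b m) i = c *: ssub r a i + ssub r b i.
Proof.
move=> fina finb; rewrite /ssub fsum_scaler -fsumD.
- apply: eq_fsbigr => m _; rewrite scalerDr !scalerA; congr (_ *: _ + _).
  exact: mulrC.
- apply: sub_finite_set fina => m /=; rewrite !scaler_eq0 !negb_or.
  by move=> /and3P[].
- apply: sub_finite_set finb => m /=; rewrite !scaler_eq0 !negb_or.
  by move=> /andP[].
Qed.

(** Serves to move the operators Y(u, x1), and module morphisms, past the substitution of f(x). *)
Lemma linear_ssub (M : choiceType) (I : Type) (r : M -> I -> K)
    (V W : lmodType K) (h : V -> W) (x : M -> V) (i : I) :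
  linear h -> finite_set [set m | x m != 0 /\ r m i != 0] ->
  h (ssub r x i) = ssub r (fun m => h (x m)) i.
Proof.
move=> hl fin; rewrite /ssub (fsum_linear hl); last first.
  by apply: sub_finite_set fin => m /=; rewrite scaler_eq0 negb_or => /andP[].
apply: eq_fsbigr => m _.
have h0 : h 0 = 0 by have := hl (-1) 0 0; rewrite scaler0 add0r scaleN1r addNr.
by have := hl (r m i) (x m) 0; rewrite h0 !addr0.
Qed.

End Supports.

(** * Rings of series with prescribed supports *)

(* The axioms make the series with support in P a commutative ring: sums and
   products stay in P, and each coefficient of a product is a finite sum. *)
Record support_family (I : zmodType) (P : set (set I)) : Prop := SupportFamily {
  sfam0 : P [set 0];
  sfamS : forall S T, S `<=` T -> P T -> P S;
  sfamU : forall S T, P S -> P T -> P (S `|` T);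
  sfamD : forall S T, P S -> P T -> P (sumset S T);
  sfam_dec : forall S T, P S -> P T -> decomposable S T
}.

Lemma sfam_bigcup (I : zmodType) (P : set (set I)) (J : eqType) (D : set J)
    (G : J -> set I) :
  support_family P -> finite_set D -> (forall j, D j -> P (G j)) ->
  P (\bigcup_(j in D) G j).
Proof.
move=> sP /finite_seqP[s ->]; elim: s => [|j s IHs] PG.
  by apply: (sfamS sP) (sfam0 sP) => i [].
apply: (sfamS sP) (sfamU sP (PG j _) (IHs _)) => /=.
- move=> i [k /= ]; rewrite inE => /orP[/eqP->|ks] Gi; first by left.
  by right; exists k.
- by rewrite inE eqxx.
- by move=> k ks; apply: PG; rewrite /= inE ks orbT.
Qed.

(** Integral powers are handled through the recursion a^(m+1) = a a^m, which for a unit can be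
    followed in both directions. *)
Lemma int_ind2 (P : int -> Prop) :
  P 0 -> (forall m, P m -> P (m + 1)) -> (forall m, P (m + 1) -> P m) ->
  forall m, P m.
Proof.
move=> P0 Pup Pdown; case=> n.
  by elim: n => // n IHn; have := Pup _ IHn; rewrite -PoszD addn1.
elim: n => [|n IHn]; apply: Pdown; first by have -> : Negz 0 + 1 = 0 by [].
by have -> : Negz n.+1 + 1 = Negz n by lia.
Qed.

Section SeriesRings.
Variables (K : fieldType) (I : zmodType) (P : set (set I)).
Hypothesis sP : support_family P.

Definition series_in : set (I -> K) := [set a | P (supp (a : I -> K^o))].

Lemma supp_monom (i : I) : supp (monom K i : I -> K^o) `<=` [set i].
Proof.
move=> j; rewrite /supp /= /monom; have [->//|_] := eqVneq j i.
by rewrite eqxx.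
Qed.

Lemma series_one : series_in (@sone K I).
Proof. by apply: (sfamS sP) (sfam0 sP); exact: supp_monom. Qed.

Lemma sfam_smul (W : lmodType K) (a : I -> K) (b : I -> W) :
  series_in a -> P (supp b) -> P (supp (smul a b)).
Proof. by move=> Pa Pb; apply: (sfamS sP) (sfamD sP Pa Pb); exact: supp_smul. Qed.

Lemma series_mul a b : series_in a -> series_in b -> series_in (smulK a b).
Proof. exact: (@sfam_smul K^o). Qed.

Lemma sfam_smulA (W : lmodType K) (a b : I -> K) (c : I -> W) :
  series_in a -> series_in b -> P (supp c) ->
  smul (smulK a b) c = smul a (smul b c).
Proof.
move=> Pa Pb Pc; apply: smulKA; apply: (sfam_dec sP) => //.
exact: (sfamD sP).
Qed.

Lemma smulK1 (a : I -> K) : smulK (@sone K I) a = a.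
Proof. exact: (@smul1 K I K^o a). Qed.

Lemma series_mulA a b c : series_in a -> series_in b -> series_in c ->
  smulK (smulK a b) c = smulK a (smulK b c).
Proof. exact: (@sfam_smulA K^o). Qed.

Lemma series_mulCA a b c : series_in a -> series_in b -> series_in c ->
  smulK a (smulK b c) = smulK b (smulK a c).
Proof.
by move=> Pa Pb Pc; rewrite -!series_mulA // (smulKC a).
Qed.

Lemma series_exp a n : series_in a -> series_in (sexpn a n).
Proof.
by move=> Pa; elim: n => [|n IHn]; [exact: series_one|exact: series_mul].
Qed.

Lemma series_expM a b n : series_in a -> series_in b ->
  sexpn (smulK a b) n = smulK (sexpn a n) (sexpn b n).
Proof.
move=> Pa Pb; elim: n => [|n IHn]; first by rewrite smulK1.
have := (series_exp n Pa, series_exp n Pb) => -[Pan Pbn].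
rewrite /sexpn /= -!/(sexpn _ n) IHn.
rewrite !series_mulA //; try exact: series_mul.
by congr smulK; rewrite series_mulCA.
Qed.

Definition series_unit (a : I -> K) : Prop :=
  series_in a /\ exists2 b, series_in b & smulK a b = @sone K I.

Notation expz := (sexpz series_in).

(** Inverses are unique in the ring, so the choice made by [xget] can only return b. *)
Lemma sinvE a b : series_in a -> series_in b -> smulK a b = @sone K I ->
  sinv series_in a = b.
Proof.
move=> Pa Pb ab; rewrite /sinv; case: xgetP => [c _ [Pc ac]|]; last first.
  by move=> /(_ b); case.
by rewrite -[c]smulK1 -ab (smulKC a) series_mulA // ac smulKC smulK1.
Qed.

Lemma series_unitV a : series_unit a ->
  series_in (sinv series_in a) /\ smulK a (sinv series_in a) = @sone K I.
Proof. by case=> Pa [b Pb ab]; rewrite (sinvE Pa Pb ab). Qed.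

Lemma sexpz_in a m : series_unit a -> series_in (expz a m).
Proof.
move=> ua; have [Pa _] := ua; have [Pb _] := series_unitV ua.
by case: m => n; exact: series_exp.
Qed.

Lemma sexpzS a m : series_unit a -> expz a (m + 1) = smulK a (expz a m).
Proof.
move=> ua; have [Pa _] := ua; have [Pb ab] := series_unitV ua.
case: m => n; first by rewrite -PoszD addn1.
have -> : expz a (Negz n) = smulK (sinv series_in a) (sexpn (sinv series_in a) n).
  by [].
rewrite -series_mulA //; last exact: series_exp.
rewrite ab smulK1; case: n => [//|n].
by have -> : Negz n.+1 + 1 = Negz n by lia.
Qed.

Lemma sexpz1 a : expz a 1 = a.
Proof. by rewrite /sexpz /sexpn /= smulKC smulK1. Qed.

Lemma smulK_unitI a b c : series_unit a -> series_in b -> series_in c ->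
  smulK a b = smulK a c -> b = c.
Proof.
move=> ua Pb Pc e; have [Pa _] := ua; have [Pi ai] := series_unitV ua.
rewrite -(smulK1 b) -(smulK1 c) -ai (smulKC a) !series_mulA //.
by rewrite e.
Qed.

Lemma sexpz_uniq a (X : int -> I -> K) : series_unit a ->
  (forall m, series_in (X m)) -> X 0 = @sone K I ->
  (forall m, X (m + 1) = smulK a (X m)) -> forall m, X m = expz a m.
Proof.
move=> ua PX X0 XS; apply: int_ind2 => // m; first by rewrite XS sexpzS // => ->.
rewrite XS sexpzS // => /smulK_unitI -> //; exact: sexpz_in.
Qed.

Lemma sexpzD a m n : series_unit a ->
  expz a (m + n) = smulK (expz a m) (expz a n).
Proof.
move=> ua; have [Pa _] := ua; have Pz k := sexpz_in k ua.
elim/int_ind2: m => [|m IHm|m]; first by rewrite add0r smulK1.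
  by rewrite addrAC !sexpzS // IHm series_mulA.
rewrite addrAC !sexpzS // series_mulA // => /smulK_unitI -> //.
exact: series_mul.
Qed.

(** With T a submonoid, a lies in x^d times series supported in T and its inverse b in x^(-d) times
    such series; hence a^m lies in x^(md) times such series, with the same T for all m. *)
Lemma sexpz_supp a b (T : set I) (d : I) : series_unit a -> series_in b ->
    smulK a b = @sone K I -> T 0 -> (forall s t, T s -> T t -> T (s + t)) ->
    (forall i, a i != 0 -> T (i - d)) -> (forall i, b i != 0 -> T (i + d)) ->
  forall m i, expz a m i != 0 -> T (i - d *~ m).
Proof.
move=> ua Pb ab T0 TD Ta Tb; have [Pa _] := ua.
elim/int_ind2 => [i|m IHm i|m IHm i].
- by rewrite mulr0z subr0 => /supp_monom ->.
- rewrite sexpzS // => /supp_smul[s /Ta Tas /IHm Tis].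
  have := TD _ _ Tas Tis; rewrite addrACA [s + (i - s)]addrC subrK.
  by rewrite mulrzDr mulr1z (addrC (d *~ m)) opprD.
- have -> : expz a m = smulK b (expz a (m + 1)).
    rewrite sexpzS // -series_mulA //; last exact: sexpz_in.
    by rewrite (smulKC b) ab smulK1.
  move=> /supp_smul[s /Tb Tas /IHm Tis].
  have := TD _ _ Tas Tis; rewrite addrACA [s + (i - s)]addrC subrK.
  by rewrite mulrzDr mulr1z (addrC (d *~ m)) opprD addNKr.
Qed.

End SeriesRings.

(** * Substitutions as homomorphisms between rings of series *)

Section Substitution.
Variable K : fieldType.

Definition admissible (M I : Type) (r : M -> I -> K) (P : set (set M))
    (Q : set (set I)) : Prop :=
  forall D, P D -> Q (image_supp r D) /\ locally_finite r D.

Definition power_family (M I : zmodType) (r : M -> I -> K) : Prop :=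
  r 0 = @sone K I /\ forall k l, r (k + l) = smulK (r k) (r l).

Lemma power_family_sexpz (I : zmodType) (P : set (set I)) (a : I -> K) :
  support_family P -> series_unit P a ->
  power_family (sexpz (@series_in K I P) a).
Proof. by move=> sP ua; split=> // k l; exact: sexpzD. Qed.

Section Homomorphism.
Variables (M I : zmodType) (P : set (set M)) (Q : set (set I)).
Variable r : M -> I -> K.
Hypotheses (sQ : support_family Q) (rPQ : admissible r P Q).

Lemma sfam_ssub (W : lmodType K) (a : M -> W) :
  P (supp a) -> Q (supp (ssub r a)).
Proof. by case/rPQ => Qr _; apply: (sfamS sQ) Qr; exact: supp_ssub. Qed.

Lemma series_ssub (a : M -> K) : series_in P a -> series_in Q (ssubK r a).
Proof. exact: (@sfam_ssub K^o). Qed.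

Lemma ssub_mul (W : lmodType K) (a : M -> K) (b : M -> W) :
  power_family r -> series_in P a -> P (supp b) ->
  ssub r (smul a b) = smul (ssubK r a) (ssub r b).
Proof.
move=> [_ rM] Pa Pb; have [Qa la] := rPQ Pa; have [Qb lb] := rPQ Pb.
by apply: ssub_smul la lb _ _ => //; exact: (sfam_dec sQ).
Qed.

Lemma ssubK_mul (a b : M -> K) :
  power_family r -> series_in P a -> series_in P b ->
  ssubK r (smulK a b) = smulK (ssubK r a) (ssubK r b).
Proof. exact: (@ssub_mul K^o). Qed.

Lemma ssubK_monom m : ssubK r (monom K m) = r m.
Proof.
apply/funext => i; rewrite /ssubK /ssub (fsum1 (i := m)) /monom ?eqxx.
  by rewrite [_ *: _]mulr1.
by move=> j /negPf ->; rewrite scaler0.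
Qed.

Hypotheses (sP : support_family P) (rM : power_family r).

Lemma ssubK_one : ssubK r (@sone K M) = @sone K I.
Proof. by rewrite ssubK_monom; case: rM. Qed.

Lemma ssubK_unit a : series_unit P a -> series_unit Q (ssubK r a).
Proof.
case=> Pa [b Pb ab]; split; first exact: series_ssub.
by exists (ssubK r b); [exact: series_ssub|rewrite -ssubK_mul // ab ssubK_one].
Qed.

(** The images of the powers of a satisfy the recursion of [sexpz_uniq], so negative powers need no
    separate argument. *)
Lemma ssubK_sexpz a m : series_unit P a ->
  ssubK r (sexpz (@series_in K M P) a m) =
  sexpz (@series_in K I Q) (ssubK r a) m.
Proof.
move=> ua; have uQ := ssubK_unit ua; have Pz k := sexpz_in sP k ua.
apply: (sexpz_uniq sQ uQ (X := fun m => ssubK r (sexpz _ a m))) => //= {m}.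
- by move=> m; exact: series_ssub.
- exact: ssubK_one.
- by move=> m; rewrite (sexpzS sP) // ssubK_mul //; case: ua.
Qed.

End Homomorphism.

Lemma admissible_comp (M N I : zmodType) (P : set (set M)) (Q : set (set N))
    (R : set (set I)) (s : M -> N -> K) (r : N -> I -> K) :
  support_family R -> admissible s P Q -> admissible r Q R ->
  admissible (fun m => ssubK r (s m)) P R.
Proof.
move=> sR sPQ rQR D /sPQ[/rQR [Rr lr] ls].
have key m i : D m -> ssubK r (s m) i != 0 ->
    exists n, [/\ image_supp s D n, r n i != 0 & s m n != 0].
  move=> Dm /(@supp_ssub _ _ _ _ K^o) [n sn rn]; exists n; split=> //.
  by exists m.
split.
  apply: (sfamS sR) Rr => i [m Dm] /(key _ _ Dm)[n [Dn rn _]].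
  by exists n.
move=> i; apply: (@sub_finite_set _ _ (\bigcup_(n in [set n |
    image_supp s D n /\ r n i != 0]) [set m | D m /\ s m n != 0])).
  by move=> m [Dm] /(key _ _ Dm)[n [Dn rn sn]]; exists n.
by apply: bigcup_finite => [|n _].
Qed.

Lemma ssubA (M N I : zmodType) (P : set (set M)) (Q : set (set N))
    (R : set (set I)) (s : M -> N -> K) (r : N -> I -> K) (W : lmodType K)
    (a : M -> W) :
  admissible s P Q -> admissible r Q R -> P (supp a) ->
  ssub r (ssub s a) = ssub (fun m => ssubK r (s m)) a.
Proof.
move=> sPQ rQR Pa; have [/rQR[_ lr] ls] := sPQ _ Pa.
exact: ssub_comp ls lr.
Qed.

Lemma eq_ssub (M I : zmodType) (r s : M -> I -> K) (W : lmodType K)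
    (a : M -> W) : (forall m, r m = s m) -> ssub r a = ssub s a.
Proof. by move=> /funext ->. Qed.

Lemma ssub_id (M : zmodType) (W : lmodType K) (a : M -> W) :
  ssub (@monom K M) a = a.
Proof.
apply/funext => i; rewrite /ssub (fsum1 (i := i)) /monom ?eqxx ?scale1r //.
by move=> j; rewrite eq_sym => /negPf ->; rewrite scale0r.
Qed.

End Substitution.

(** * Laurent series and iterated Laurent series *)

Section SupportFamilies.

Definition bounded_below : set (set int) :=
  [set S | exists N : int, forall s, S s -> N <= s].

(** Laurent series in the last variable with coefficients supported in P. The condition on the first
    variable is imposed for each n separately: the orders of the coefficients may tend to minus
    infinity as n grows. *)
Definition lex_family (I : zmodType) (P : set (set I)) : set (set (I * int)) :=
  [set S | (exists N : int, forall p, S p -> N <= p.2) /\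
           forall n, P [set i | S (i, n)]].

Definition lex0_family (I : zmodType) (P : set (set I)) : set (set (I * int)) :=
  [set S | (forall p, S p -> 0 <= p.2) /\ forall n, P [set i | S (i, n)]].

Lemma finite_int_interval (a b : int) : finite_set [set k : int | a <= k <= b].
Proof.
apply: (@sub_finite_set _ _ ((fun n : nat => a + n%:Z) @` `I_(`|b - a|%N.+1))).
  by move=> k /= /andP[ak kb]; exists `|k - a|%N; lia.
exact/finite_image/finite_II.
Qed.

Lemma bounded_below_family : support_family bounded_below.
Proof.
split.
- by exists 0 => s ->.
- by move=> S T ST [N TN]; exists N => s /ST/TN.
- move=> S T [N SN] [N' TN]; exists (Num.min N N') => s [/SN|/TN]; lia.
- move=> S T [N SN] [N' TN]; exists (N + N') => s [k /SN + /TN]; lia.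
- move=> S T [N SN] [N' TN] i.
  apply: sub_finite_set (finite_int_interval N (i - N')) => s /= [/SN + /TN].
  lia.
Qed.

Variables (I : zmodType) (P : set (set I)).
Hypothesis sP : support_family P.

Lemma lex_family_family : support_family (lex_family P).
Proof.
split.
- split; first by exists 0 => p ->.
  by move=> n; apply: (sfamS sP) (sfam0 sP) => i /= [].
- move=> S T ST [[N TN] PT]; split; first by exists N => s /ST/TN.
  by move=> n; apply: (sfamS sP) (PT n) => i /ST.
- move=> S T [[N SN] PS] [[N' TN] PT]; split.
    by exists (Num.min N N') => s [/SN|/TN]; lia.
  by move=> n; apply: (sfamS sP) (sfamU sP (PS n) (PT n)) => i.
- move=> S T [[N SN] PS] [[N' TN] PT]; split.
    by exists (N + N') => -[i n] [[j k] /SN /= Nk]; move/TN; rewrite /=; lia.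
  (* The last exponent n splits as k + (n - k) with N <= k and N' <= n - k, in finitely many
     ways. *)
  move=> n; apply: (@sfamS _ _ sP _ (\bigcup_(k in [set k | N <= k <= n - N'])
      sumset [set i | S (i, k)] [set i | T (i, n - k)])).
    move=> i [[j k] Sjk Tik]; exists k; last by exists j.
    by move: (SN _ Sjk) (TN _ Tik) => /=; lia.
  apply: sfam_bigcup => // [|k _]; first exact: finite_int_interval.
  exact: (sfamD sP).
- move=> S T [[N SN] PS] [[N' TN] PT] [i n].
  apply: (@sub_finite_set _ _ (\bigcup_(k in [set k | N <= k <= n - N'])
    ((pair^~ k) @` [set j | S (j, k) /\ T (i - j, n - k)]))).
    move=> [j k] [Sjk Tik]; exists k; last by exists j.
    by move: (SN _ Sjk) (TN _ Tik) => /=; lia.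
  apply: bigcup_finite => [|k _]; first exact: finite_int_interval.
  by apply: finite_image; exact: (sfam_dec sP (PS k) (PT (n - k))).
Qed.

Lemma lex0_lex S : lex0_family P S -> lex_family P S.
Proof. by case=> S0 PS; split=> //; exists 0. Qed.

Lemma lex0_family_family : support_family (lex0_family P).
Proof.
have sL := lex_family_family; split.
- split; first by move=> p ->.
  by case: (sfam0 sL).
- move=> S T ST TL; split; first by case: TL => T0 _ s /ST/T0.
  by case: (sfamS sL ST (lex0_lex TL)).
- move=> S T SL TL; split; first by case: SL TL => S0 _ [T0 _] p [/S0|/T0].
  by case: (sfamU sL (lex0_lex SL) (lex0_lex TL)).
- move=> S T SL TL; split; last by case: (sfamD sL (lex0_lex SL) (lex0_lex TL)).
  case: SL TL => S0 _ [T0 _] [i n] [[j k] /S0 /= k0 /T0]; rewrite /=; lia.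
- by move=> S T /lex0_lex SL /lex0_lex TL; exact: (sfam_dec sL).
Qed.

End SupportFamilies.

(** * Inverting series with a leading monomial *)

Section GeometricInverse.
Variables (K : fieldType) (I : zmodType) (P : set (set I)).
Hypothesis sP : support_family P.
Variables (T : set I) (w : I -> int).
Hypotheses (PT : P T) (T0 : T 0) (TD : forall s t, T s -> T t -> T (s + t)).
Hypotheses (wD : forall s t, w (s + t) = w s + w t).

(* The inverse of 1 - u is obtained by substituting u for t in \sum_k t^k. *)
Lemma geometric_inverse (u : I -> K) :
  (forall i, u i != 0 -> T i /\ 1 <= w i) ->
  exists2 v : I -> K, (forall i, v i != 0 -> T i) &
    smulK (fun i => @sone K I i - u i) v = @sone K I.
Proof.
move=> uT.
(* Since u need not be invertible, the negative powers are replaced by 0; the family is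
   multiplicative on nonnegative exponents, which is enough here. *)
pose e (k : int) : I -> K := if k is Posz n then sexpn u n else fun=> 0.
have w0 : w 0 = 0 by apply: (addrI (w 0)); rewrite -wD !addr0.
(* Every exponent of u has weight at least 1, so u^k starts at weight k and only the powers with k
   <= w i reach the coefficient i. *)
have eT k i : e k i != 0 -> [/\ T i, 0 <= k & k <= w i].
  case: k => n; last by rewrite eqxx.
  elim: n i => [|n IHn] i; first by move=> /supp_monom ->; rewrite w0.
  move=> /supp_smul[s /uT[Ts ws] /IHn[Tis _ wis]].
  have := TD Ts Tis; have := wD s (i - s); rewrite addrCA subrr addr0 => e1 e2.
  split=> //; rewrite e1 -add1n PoszD; exact: lerD.
have lfe : locally_finite e setT.
  move=> i; apply: sub_finite_set (finite_int_interval 0 (w i)) => k [_].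
  by move=> /eT[_ k0 kw] /=; rewrite k0.
have PeT D : P (image_supp e D).
  by apply: (sfamS sP) PT => i [k _ /eT[]].
(* As series in t, [ones] is 1 / (1 - t) and [pos] is t / (1 - t); the inverse of 1 - u comes from 1
   / (1 - t) = 1 + t / (1 - t). *)
pose ones : int -> K := fun k => (0 <= k)%R%:R.
pose pos : int -> K := fun k => (1 <= k)%R%:R.
have uP : series_in P u by apply: (sfamS sP) PT => i /uT[].
have ue : ssubK e pos = smulK u (ssubK e ones).
  have -> : pos = smulK (monom K 1) ones.
    apply/funext => k; rewrite /smulK smul_monom /pos /ones.
    by congr (_%:R); congr nat_of_bool; lia.
  have -> : u = ssubK e (monom K (1 : int)).
    by rewrite ssubK_monom /e /sexpn /= smulKC smulK1.
  apply: (@ssub_smul _ _ _ _ K^o _ _ [set k | 0 <= k] [set k | 0 <= k]).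
  - by move=> k /supp_monom ->.
  - by move=> k; rewrite /supp /ones /=; case: (0 <= k); rewrite ?eqxx.
  - by move=> i; apply: sub_finite_set (lfe i) => k [].
  - by move=> i; apply: sub_finite_set (lfe i) => k [].
  - exact: (sfam_dec sP).
  - case=> // m [] // n _ _; rewrite -PoszD /e.
    elim: m => [|m IHm]; first by rewrite smulK1.
    rewrite /sexpn /= -!/(sexpn _ _) IHm (series_mulA sP) //; exact: series_exp.
have vE : ssubK e ones = fun i => @sone K I i + ssubK e pos i.
  apply/funext => i; have e0 : e 0 = @sone K I by [].
  rewrite -e0 -(ssubK_monom e 0).
  apply: etrans (@fsumD K K^o _ (fun k => e k i *: (monom K 0 k : K^o))
                           (fun k => e k i *: (pos k : K^o)) _ _).
  - apply: eq_fsbigr => k _; rewrite -scalerDr; congr (_ *: _).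
    rewrite /ones /pos /monom.
    by case: k => [[|n]|n] //=; rewrite ?addr0 ?add0r.
  - by apply: sub_finite_set (lfe i) => k /=; rewrite scaler_eq0 negb_or => /andP[].
  - by apply: sub_finite_set (lfe i) => k /=; rewrite scaler_eq0 negb_or => /andP[].
have vT i : ssubK e ones i != 0 -> T i.
  by move=> /(@supp_ssub _ _ _ _ K^o)[k _ /eT[]].
exists (ssubK e ones) => //; apply/funext => i.
have Pv : series_in P (ssubK e ones) by apply: (sfamS sP) PT => j; exact: vT.
rewrite smulKBl; [|exact: (sfam_dec sP (series_one K sP))|exact: (sfam_dec sP)].
by rewrite -ue smulK1 vE addrK.
Qed.

Variables (d : I) (a : I -> K).
Hypotheses (Pd : P [set d]) (PNd : P [set - d]).
Hypotheses (aT : forall i, a i != 0 -> T (i - d)).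
Hypotheses (aw : forall i, a i != monom K d i -> 1 <= w (i - d)).

(** Write a = x^d (1 - u) with u supported in T and of weight at least 1; the inverse is x^(-d)
    times the geometric series in u. The location of all powers then follows from [sexpz_supp]. *)
Lemma leading_unit :
  series_unit P a /\
  forall m i, sexpz (@series_in K I P) a m i != 0 -> T (i - d *~ m).
Proof.
pose u i : K := @sone K I i - a (i + d).
have uT i : u i != 0 -> T i /\ 1 <= w i.
  rewrite /u subr_eq0 eq_sym => ne; split.
    have [ad|ad] := eqVneq (a (i + d)) 0.
      by move: ne; rewrite ad eq_sym => /supp_monom ->.
    by have := aT ad; rewrite addrK.
  have := @aw (i + d); rewrite addrK; apply.
  by rewrite /monom -subr_eq0 addrK.
have [v vT uv] := geometric_inverse uT.
have ea : a = smulK (monom K d) (fun i => @sone K I i - u i).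
  by apply/funext => i; rewrite /smulK smul_monom /u subKr subrK.
have P1 : series_in P (monom K d).
  by apply: (sfamS sP) Pd; exact: supp_monom.
have PN1 : series_in P (monom K (- d)).
  by apply: (sfamS sP) PNd; exact: supp_monom.
have Pv : series_in P v by apply: (sfamS sP) PT => i /vT.
have P1u : series_in P (fun i => @sone K I i - u i).
  apply: (sfamS sP) PT => i; rewrite /supp /= /u subKr => /aT.
  by rewrite addrK.
have Pa : series_in P a by rewrite ea; exact: series_mul.
have ab : smulK a (smulK (monom K (- d)) v) = @sone K I.
  rewrite ea (series_mulA sP) ?(series_mulCA sP P1u) ?uv //; last exact: series_mul.
  apply/funext => i; rewrite /smulK !smul_monom opprK /sone /monom.
  by rewrite subrK.
have ua : series_unit P a.
  by split=> //; exists (smulK (monom K (- d)) v) => //; exact: series_mul.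
split=> // m i; apply: (sexpz_supp sP ua _ ab) => //; first exact: series_mul.
by move=> j; rewrite /smulK smul_monom opprK => /vT.
Qed.

End GeometricInverse.

(* FL, LP and F2 are the supports of series in W((x)), W((x))[[z]] and
   W((x))((z)). *)
Notation FL := bounded_below.
Notation LP := (lex0_family bounded_below).
Notation F2 := (lex_family bounded_below).
Definition sFL := bounded_below_family.
Definition sLP := lex0_family_family bounded_below_family.
Definition sF2 := lex_family_family bounded_below_family.

Lemma fsum_fst (K : fieldType) (W : lmodType K) (I J : choiceType) (c : J)
    (G : I * J -> W) : (forall p, p.2 != c -> G p = 0) ->
  \sum_(p \in [set: I * J]) G p = \sum_(i \in [set: I]) G (i, c).
Proof.
move=> G0.
rewrite (@fsum_sub _ _ ((fun i => (i, c)) @` [set: I])); last first.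
  move=> [i j] Gij; exists i => //; congr pair; apply/eqP.
  by apply: contra_neqT Gij; rewrite eq_sym => /(G0 (i, j)).
by rewrite fsbig_image // => i j _ _ [].
Qed.

Lemma fsum_snd (K : fieldType) (W : lmodType K) (I J : choiceType) (c : I)
    (G : I * J -> W) : (forall p, p.1 != c -> G p = 0) ->
  \sum_(p \in [set: I * J]) G p = \sum_(j \in [set: J]) G (c, j).
Proof.
move=> G0.
rewrite (@fsum_sub _ _ ((fun j => (c, j)) @` [set: J])); last first.
  move=> [i j] Gij; exists j => //; congr pair; apply/eqP.
  by apply: contra_neqT Gij; rewrite eq_sym => /(G0 (i, j)).
by rewrite fsbig_image // => i j _ _ [].
Qed.

(** * Powers of f(x) and of phi(x, z) *)

Section Powers.
Variable K : fieldType.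
Implicit Types (f g : int -> K) (phi : int * int -> K).

Lemma laurent_seriesE (W : lmodType K) (a : int -> W) :
  laurent_series a <-> FL (supp a).
Proof.
split=> -[N aN]; exists N => n; last first.
  by apply: contraPP => /eqP /aN; lia.
by rewrite leNgt; apply: contra_neqN => /aN.
Qed.

Lemma laurent_powerE (W : lmodType K) (a : int * int -> W) :
  laurent_power a <-> LP (supp a).
Proof.
split=> -[a0 aN]; split.
- by move=> [m n] amn; rewrite leNgt; apply: contra_neqN amn => /a0.
- by move=> n; have /laurent_seriesE := aN n.
- by move=> m n n0; apply: contraPP n0 => /eqP /a0 /=; lia.
- by move=> n; apply/laurent_seriesE; exact: aN.
Qed.

Lemma pow1E f m : pow1 f m = sexpz (@series_in K int FL) f m.
Proof.
rewrite /pow1 (_ : @laurent_series K K^o = @series_in K int FL) //.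
apply/seteqP; split=> a; first exact: (proj1 (@laurent_seriesE K^o a)).
exact: (proj2 (@laurent_seriesE K^o a)).
Qed.

Lemma pow2E phi m : pow2 phi m = sexpz (@series_in K _ LP) phi m.
Proof.
rewrite /pow2 (_ : @laurent_power K K^o = @series_in K _ LP) //.
apply/seteqP; split=> a; first exact: (proj1 (@laurent_powerE K^o a)).
exact: (proj2 (@laurent_powerE K^o a)).
Qed.

Definition tangent_to_id f : Prop :=
  [/\ power_series (f : int -> K^o), f 0 = 0 & f 1 = 1].

(** The case d = 1 with T the nonnegative integers and w the identity: f is x times a series with
    constant term 1. *)
Lemma tangent_unit f : tangent_to_id f ->
  series_unit FL f /\ forall m i, pow1 f m i != 0 -> m <= i.
Proof.
move=> [f_ps f0 f1].
have [||||||||fu fT] := @leading_unit K _ FL sFL [set i | 0 <= i] id _ _ _ _ 1 f.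
- by exists 0 => ?.
- by [].
- by move=> s t /= s0 t0; rewrite addr_ge0.
- by [].
- by exists 1 => ? ->.
- by exists (-1) => ? ->.
- move=> i; apply: contra_neqT => /= i1.
  have [i0|i0] := ltP i 0; first exact: f_ps.
  by have -> : i = 0 by lia.
- move=> i; apply: contra_neqT => /= i1; rewrite /monom.
  have [->//|i1'] := eqVneq i 1.
  have [i0|i0] := ltP i 0; first exact: f_ps.
  by have -> : i = 0 by lia.
- by split=> // m i; rewrite pow1E => /fT /=; lia.
Qed.

Lemma admissible_pow1 f : tangent_to_id f -> admissible (pow1 f) FL FL.
Proof.
move=> /tangent_unit[_ fT] D [N DN]; split.
  by exists N => i [m /DN + /fT]; lia.
move=> i; apply: sub_finite_set (finite_int_interval N i) => m /= [/DN + /fT].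
lia.
Qed.

Lemma power_family_pow1 f : tangent_to_id f -> power_family (pow1 f).
Proof.
move=> /tangent_unit[fu _]; rewrite (_ : pow1 f = sexpz (@series_in K int FL) f).

  exact: (@power_family_sexpz K _ FL f sFL fu).
by apply/funext => m; exact: pow1E.
Qed.

Lemma pow1_in f m : tangent_to_id f -> series_in FL (pow1 f m).
Proof. by move=> /tangent_unit[fu _]; rewrite pow1E; exact: (sexpz_in sFL). Qed.

Lemma pow1_1 f : pow1 f 1 = f.
Proof. by rewrite pow1E sexpz1. Qed.

Lemma pow2_1 phi : pow2 phi 1 = phi.
Proof. by rewrite pow2E sexpz1. Qed.

Definition tangent_to_fst phi : Prop :=
  laurent_power (phi : int * int -> K^o) /\ forall m, phi (m, 0) = monom K 1 m.

(* A bound of this shape is multiplicative: it makes the coefficient of z^n in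
   phi^m of order at least m - E n * n in x, uniformly in m. *)
Lemma laurent_power_slope phi : laurent_power (phi : int * int -> K^o) ->
  exists E : int -> int, (forall b, 0 <= E b) /\
    forall b i n, 1 <= n <= b -> phi (i, n) != 0 -> 1 - E b * n <= i.
Proof.
case=> _ phiN.
have [N NP] := choice phiN.
have H (b : nat) : exists E, 0 <= E /\
    forall i n, 1 <= n <= b%:Z -> phi (i, n) != 0 -> 1 - E <= i.
  elim: b => [|b [E [E0 EP]]]; first by exists 0; split=> // i n; lia.
  (* The old E still serves n <= b; for n = b + 1 the added term gives 1 - E' <= N b.+1 for the new
     value E'. *)
  exists (E + `|N b.+1| + 1); split=> [|i n nb pn]; first by lia.
  have [nb'|nb'] := leP n b; first by have := EP i n; lia.
  have e : n = b.+1 by lia.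
  suff : N b.+1 <= i by lia.
  by rewrite leNgt; apply: contra_neqN pn => /NP; rewrite -e.
have [E EP] := choice H.
exists (fun b => E `|b|%N); split=> [b|b i n nb pn]; first by have [] := EP `|b|%N.
have [E0 /(_ i n) Ei] := EP `|b|%N.
suff : E `|b|%N <= E `|b|%N * n by have := Ei _ pn; lia.
by rewrite ler_peMr //; lia.
Qed.

Lemma tangent_fst_unit phi : tangent_to_fst phi ->
  series_unit LP phi /\ admissible (pow2 phi) FL LP.
Proof.
move=> [phi_lp phi1]; have [E [E0 EP]] := laurent_power_slope phi_lp.
(* Quantifying over all b above the degree makes T closed under addition: for exponents n and k in z
   and b >= n + k, both summands satisfy the bound with the same slope E b. *)
pose T := [set p : int * int | 0 <= p.2 /\
  forall b, p.2 <= b -> - (E b * p.2) <= p.1].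
have LT : LP T.
  by split=> [p []//|n]; exists (- (E n * n)) => i [_]; apply.
have TD s t : T s -> T t -> T (s + t).
  move: s t => [i n] [j k] [/= n0 Hn] [/= k0 Hk]; split=> /=; first by lia.
  move=> b nkb; have := Hn b; have := Hk b; rewrite mulrDr; lia.
have [||||||phiu phiT] := @leading_unit K _ LP sLP T snd LT _ TD _ (1, 0) phi.
- by split=> //= b _; rewrite mulr0.
- by [].
- by split=> [p ->//|n]; exists 1 => i [->].
- by split=> [p ->//|n]; exists (-1) => i [->].
- move=> [i n] pn; rewrite /T /= subr0.
  have [n0|n0] := ltP n 0; first by case: phi_lp pn => -> //; rewrite eqxx.
  split=> // b nb; have [en|nn0] := eqVneq n 0.
    move: pn; rewrite en phi1 => /supp_monom ->.
    by rewrite mulr0 subrr.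
  have := EP b i n; rewrite pn; lia.
- move=> [i n]; apply: contra_neqT => /=; rewrite subr0 => n1.
  rewrite /monom; have [n0|n0] := ltP n 0.
    by case: phi_lp => ->// _; rewrite xpair_eqE (_ : (n == 0) = false) ?andbF //; lia.
  by have -> : n = 0 by [lia]; rewrite phi1 xpair_eqE eqxx andbT.
split=> // D [N DN].
(* The choice b = n gives a bound whose slope does not depend on m. So for m >= N the order at z^n
   is at least N - E n * n, and only m <= i + E n * n can reach the coefficient (i, n). *)
have powT m i n : pow2 phi m (i, n) != 0 -> 0 <= n /\ m - E n * n <= i.
  rewrite pow2E => /phiT [].
  have -> : ((1, 0) : int * int) *~ m = (m, 0).
    elim/int_ind2: m => [|m IHm|m IHm]; first by [].
      by rewrite mulrzDr IHm mulr1z; congr pair; rewrite /= addr0.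
    apply: (addIr (1, 0)); rewrite -[X in _ + X = _]mulr1z -mulrzDr IHm.
    by congr pair; rewrite /= addr0.
  rewrite /= subr0 => n0 /(_ n (lexx n)); split=> //; lia.
split.
  split=> [[i n] [m _ /powT[]]//|n]; exists (N - E n * n) => i [m /DN + /powT[_]].
  lia.
move=> [i n]; apply: sub_finite_set (finite_int_interval N (i + E n * n)) => m /=.
move=> [/DN + /powT[_]]; lia.
Qed.

Lemma power_family_pow2 phi : series_unit LP phi -> power_family (pow2 phi).
Proof.
move=> phiu; rewrite (_ : pow2 phi = sexpz (@series_in K _ LP) phi).
  exact: (@power_family_sexpz K _ LP phi sLP phiu).
by apply/funext => m; exact: pow2E.
Qed.

Lemma pow2_in phi m : series_unit LP phi -> series_in LP (pow2 phi m).
Proof. by rewrite pow2E; exact: (sexpz_in sLP). Qed.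

End Powers.

(** * Change of variable in several variables *)

Section Tensor.
Variable K : fieldType.

Definition tens (M N I J : Type) (r : M -> I -> K) (s : N -> J -> K)
    (p : M * N) (q : I * J) : K :=
  r p.1 q.1 * s p.2 q.2.

Lemma smul_tens (I J : zmodType) (a c : I -> K) (b d : J -> K) :
  decomposable (supp (a : I -> K^o)) (supp (c : I -> K^o)) ->
  decomposable (supp (b : J -> K^o)) (supp (d : J -> K^o)) ->
  smulK (fun q : I * J => a q.1 * b q.2) (fun q => c q.1 * d q.2) =
  fun q => smulK a c q.1 * smulK b d q.2.
Proof.
move=> dac dbd; apply/funext => -[i j] /=.
rewrite /smulK /smul; apply/esym.
rewrite [LHS](@fsum_mul K K^o _ _ (fun k => a k * c (i - k))
                                  (fun l => b l * d (j - l))).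
- by apply: eq_fsbigr => -[k l] _ /=; exact: mulrACA.
- by apply: sub_finite_set (dac i) => k /=; rewrite mulf_eq0 negb_or => /andP[].
- by apply: sub_finite_set (dbd j) => k /=; rewrite mulf_eq0 negb_or => /andP[].
Qed.

Lemma monom_pair (I J : zmodType) (p : I * J) :
  monom K p = fun q => monom K p.1 q.1 * monom K p.2 q.2.
Proof.
apply/funext => q; rewrite /monom -natrM mulnb.
by case: p q => [i j] [k l]; rewrite xpair_eqE.
Qed.

Lemma power_family_tens (M N I J : zmodType) (P : set (set I)) (Q : set (set J))
    (r : M -> I -> K) (s : N -> J -> K) :
  support_family P -> support_family Q ->
  (forall m, series_in P (r m)) -> (forall n, series_in Q (s n)) ->
  power_family r -> power_family s -> power_family (tens r s).
Proof.
move=> sP sQ Pr Qs [r0 rD] [s0 sD]; split.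
  by apply/funext => q; rewrite /tens r0 s0 /sone monom_pair.
move=> [k m] [l n]; rewrite [RHS]smul_tens.
- by apply/funext => -[i j]; rewrite /tens /= rD sD.
- exact: (sfam_dec sP (Pr _) (Pr _)).
- exact: (sfam_dec sQ (Qs _) (Qs _)).
Qed.

Section Admissible.
Variables (M I : zmodType) (P : set (set M)) (Q : set (set I)).
Variables (r : M -> I -> K) (s : int -> int -> K).
Hypotheses (sQ : support_family Q) (rPQ : admissible r P Q).
Hypothesis s_le : forall n b, s n b != 0 -> n <= b.

(** As s is triangular, only n between N and b contribute to the exponent b, and each of these
    finitely many slices is handled by the hypothesis on r. *)
Lemma admissible_tens :
  admissible (tens r s) (lex_family P) (lex_family Q).
Proof.
move=> D [[N DN] PD]; split; last first.
  move=> [i b]; apply: (@sub_finite_set _ _ (\bigcup_(n in [set n | N <= n <= b])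
      (pair^~ n) @` [set m | D (m, n) /\ r m i != 0])).
    move=> [m n] [Dmn]; rewrite mulf_eq0 negb_or => /andP[/= rmi /s_le nb].
    by exists n; [rewrite /= nb andbT; exact: (DN _ Dmn)|exists m].
  apply: bigcup_finite => [|n _]; first exact: finite_int_interval.
  by apply: finite_image; have [_] := rPQ (PD n); apply.
split.
  exists N => -[i b] [[m n] Dmn]; rewrite mulf_eq0 negb_or.
  by move=> /andP[_ /s_le]; apply: le_trans; exact: (DN _ Dmn).
move=> b; apply: (sfamS sQ _ (sfam_bigcup sQ (finite_int_interval N b)
    (G := fun n => image_supp r [set m | D (m, n)]) _)).
  move=> i [[m n] Dmn]; rewrite mulf_eq0 negb_or => /andP[/= rmi /s_le nb].
  by exists n; [rewrite /= nb andbT; exact: (DN _ Dmn)|exists m].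
by move=> n _; have [] := rPQ (PD n).
Qed.

Lemma admissible_tens0 :
  admissible (tens r s) (lex0_family P) (lex0_family Q).
Proof.
move=> D PD; have [[_ im] lf] := admissible_tens (lex0_lex PD).
split=> //; split=> // -[i b] [[m n] Dmn]; rewrite mulf_eq0 negb_or.
move=> /andP[_ /s_le]; apply: le_trans; case: PD => D0 _.
exact: (D0 _ Dmn).
Qed.

End Admissible.

Lemma ssubK_tens (M N I J : zmodType) (r : M -> I -> K) (s : N -> J -> K)
    (a : M -> K) (b : N -> K) :
  locally_finite r (supp (a : M -> K^o)) ->
  locally_finite s (supp (b : N -> K^o)) ->
  ssubK (tens r s) (fun p => a p.1 * b p.2) =
  fun q => ssubK r a q.1 * ssubK s b q.2.
Proof.
move=> lr ls; apply/funext => -[i j]; apply/esym.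
rewrite [LHS](@fsum_mul K K^o _ _ (fun k => r k i * a k) (fun l => s l j * b l)).
- by apply: eq_fsbigr => -[k l] _ /=; exact: mulrACA.
- apply: sub_finite_set (lr i) => k /=.
  by rewrite mulf_eq0 negb_or => /andP[rk ak].
- apply: sub_finite_set (ls j) => k /=.
  by rewrite mulf_eq0 negb_or => /andP[rk ak].
Qed.

End Tensor.

(** * Conjugation of phi by f *)

Section Conjugation.
Variable K : fieldType.
Implicit Types (f g : int -> K) (phi : int * int -> K).

(** The substitution called T in the overview, as a family of images of monomials. *)
Definition both f : int * int -> int * int -> K := tens (pow1 f) (pow1 f).

Lemma admissible_both f : tangent_to_id f -> admissible (both f) F2 F2.
Proof.
move=> tf; apply: (admissible_tens sFL (admissible_pow1 tf)) => n b.
by case: (tangent_unit tf) => _; apply.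
Qed.

Lemma admissible_both0 f : tangent_to_id f -> admissible (both f) LP LP.
Proof.
move=> tf; apply: (admissible_tens0 sFL (admissible_pow1 tf)) => n b.
by case: (tangent_unit tf) => _; apply.
Qed.

Lemma power_family_both f : tangent_to_id f -> power_family (both f).
Proof.
move=> tf; apply: (power_family_tens sFL sFL); try exact: power_family_pow1.
  by move=> m; exact: pow1_in.
by move=> m; exact: pow1_in.
Qed.

Lemma subst_bothE f phi : subst_both f phi = ssubK (both f) phi.
Proof.
apply/funext => p; apply: eq_fsbigr => q _; rewrite [_ *: _]mulrC //.
Qed.

Section TwoSeries.
Variables f g : int -> K.
Hypotheses (tf : tangent_to_id f) (tg : tangent_to_id g).
Hypotheses (gf : subst1K f g = monom K 1).

Lemma subst1_pow m : ssubK (pow1 f) (pow1 g m) = monom K m.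
Proof.
have [ug _] := tangent_unit tg.
rewrite pow1E (ssubK_sexpz sFL (admissible_pow1 tf) sFL (power_family_pow1 tf)) //.
rewrite -[ssubK _ _]/(subst1K f g) gf.
have u1 : series_unit FL (monom K 1).
  rewrite -gf -[subst1K f g]/(ssubK (pow1 f) g).
  exact: (ssubK_unit sFL (admissible_pow1 tf) (power_family_pow1 tf)).
apply/esym; apply: (sexpz_uniq sFL u1 (X := fun m : int => monom K m)) => //.
  by move=> k; exists k => j /supp_monom ->.
by move=> k; apply/funext => i; rewrite /smulK smul_monom /monom subr_eq.
Qed.

Lemma subst1K_id (W : lmodType K) (a : int -> W) :
  laurent_series a -> subst1 f (subst1 g a) = a.
Proof.
move=> /laurent_seriesE aL.
rewrite [LHS](ssubA (admissible_pow1 tg) (admissible_pow1 tf) aL).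
rewrite -[RHS]ssub_id; apply: eq_ssub => m; exact: subst1_pow.
Qed.

Lemma both_both p : ssubK (both f) (both g p) = monom K p.
Proof.
have lf m : locally_finite (pow1 f) (supp (pow1 g m : int -> K^o)).
  by have [] := admissible_pow1 tf (pow1_in m tg).
by rewrite [LHS]ssubK_tens // monom_pair; apply/funext => q; rewrite !subst1_pow.
Qed.

Lemma both_id (W : lmodType K) (a : int * int -> W) :
  F2 (supp a) -> ssub (both f) (ssub (both g) a) = a.
Proof.
move=> aF2; rewrite (ssubA (admissible_both tg) (admissible_both tf) aF2).
rewrite -[RHS]ssub_id; apply: eq_ssub => m; exact: both_both.
Qed.

(** Evaluation at z = 0 makes sense because h has no negative powers of z; as f(z) has no constant
    term, z^j with j > 0 contributes nothing there. *)
Lemma ssub_both_restrict (h : int * int -> K) a : series_in LP h ->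
  ssubK (both f) h (a, 0) = ssubK (pow1 f) (fun i => h (i, 0)) a.
Proof.
move=> [h0 _]; have [_ fle] := tangent_unit tf.
have [f0 _] := power_family_pow1 tf.
rewrite /ssubK /ssub (fsum_fst (c := 0)) => [|[i j] /= j0].
  apply: eq_fsbigr => i _.
  have f00 : pow1 f 0 0 = 1 by rewrite f0 /sone /monom eqxx.
  by have -> : both f (i, 0) (a, 0) = pow1 f i a by rewrite -[RHS]mulr1 -f00.
have [hij|hij] := eqVneq (h (i, j)) 0; first by rewrite hij scaler0.
have := h0 (i, j) hij; have := fle j 0; rewrite /both /tens /=.
have [->|_] := eqVneq (pow1 f j 0) 0; first by rewrite mulr0 scale0r.
by move=> /(_ isT); lia.
Qed.

End TwoSeries.

Lemma smul_restrict (a b : int * int -> K) i :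
  series_in LP a -> series_in LP b ->
  smulK a b (i, 0) = smulK (fun k => a (k, 0)) (fun k => b (k, 0)) i.
Proof.
move=> [a0 _] [b0 _]; rewrite /smulK /smul (fsum_fst (c := 0)) => [|[k j] /= j0].
  by apply: eq_fsbigr => k _; rewrite -[0 in X in _ *: X]subr0.
have [ae|ae] := eqVneq (a (k, j)) 0; first by rewrite ae scale0r.
have [be|be] := eqVneq (b ((i, 0) - (k, j))) 0; first by rewrite be scaler0.
have := a0 _ ae; have := b0 _ be; rewrite /=; lia.
Qed.

(** Setting z = 0 is multiplicative on K((x))[[z]] and sends phi to x. *)
Lemma pow2_restrict phi m i : tangent_to_fst phi ->
  pow2 phi m (i, 0) = monom K m i.
Proof.
move=> tphi; have [uphi _] := tangent_fst_unit tphi; have [_ phi1] := tphi.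
have [phi0 phiD] := power_family_pow2 uphi.
have Pphi k : series_in LP (pow2 phi k) by exact: pow2_in.
have step k j : pow2 phi (k + 1) (j, 0) = pow2 phi k (j - 1, 0).
  rewrite addrC phiD pow2_1 smul_restrict //; last by rewrite -(pow2_1 phi).
  have -> : (fun l => phi (l, 0)) = monom K 1 by apply/funext.
  by rewrite /smulK smul_monom.
elim/int_ind2: m i => [|m IHm|m IHm] i.
- by rewrite phi0 /sone monom_pair /= /monom eqxx mulr1.
- by rewrite step IHm /monom subr_eq.
- by have := IHm (i + 1); rewrite step addrK => ->; rewrite /monom (inj_eq (addIr _)).
Qed.

Section Conjugate.
Variables (f g : int -> K) (phi : int * int -> K).
Hypotheses (tf : tangent_to_id f) (tg : tangent_to_id g).
Hypotheses (gf : subst1K f g = monom K 1) (fg : subst1K g f = monom K 1).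
Hypothesis tphi : tangent_to_fst phi.

Let uphi : series_unit LP phi := (tangent_fst_unit tphi).1.
Let aphi : admissible (pow2 phi) FL LP := (tangent_fst_unit tphi).2.

Local Notation phibar := (conj_associate f g phi).

Lemma pow2_subst_both m :
  pow2 (subst_both f phi) m = ssubK (both f) (pow2 phi m).
Proof.
rewrite subst_bothE !pow2E.
by rewrite (ssubK_sexpz sLP (admissible_both0 tf) sLP (power_family_both tf)).
Qed.

Lemma conj_associateE : phibar = ssubK (both f) (ssubK (pow2 phi) g).
Proof.
have Pg : FL (supp (g : int -> K^o)) by rewrite -(pow1_1 g); exact: pow1_in.
rewrite [RHS](ssubA (W := K^o) aphi (admissible_both0 tf) Pg).
apply/funext => p; apply: eq_fsbigr => m _.
by rewrite pow2_subst_both; exact: mulrC.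
Qed.

Lemma pow2_conj m :
  pow2 phibar m = ssubK (both f) (ssubK (pow2 phi) (pow1 g m)).
Proof.
have [ug _] := tangent_unit tg.
have u2 : series_unit LP (ssubK (pow2 phi) g).
  exact: (ssubK_unit sLP aphi (power_family_pow2 uphi)).
rewrite conj_associateE pow2E.
rewrite -(ssubK_sexpz sLP (admissible_both0 tf) sLP (power_family_both tf)) //.
by rewrite -(ssubK_sexpz sLP aphi sFL (power_family_pow2 uphi)) // pow1E.
Qed.

Lemma conj_tangent : tangent_to_fst phibar.
Proof.
have Pg := pow1_in 1 tg; rewrite pow1_1 in Pg.
have Ph := series_ssub sLP aphi Pg.
split.
  apply/laurent_powerE; rewrite conj_associateE.
  exact: (series_ssub sLP (admissible_both0 tf) Ph).
move=> m; rewrite conj_associateE (ssub_both_restrict tf) // -gf.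
congr (ssubK _ _ _); apply/funext => i.
rewrite /ssubK /ssub -[RHS](congr1 (@^~ i) (ssub_id (g : int -> K^o))).
by apply: eq_fsbigr => k _; rewrite pow2_restrict.
Qed.

(** The cancellation used is f(g(x)) = x, applied inside T; [conj_tangent] uses the other one,
    g(f(x)) = x. *)
Lemma ssub_pow2_conj m :
  ssubK (pow2 phibar) (pow1 f m) = ssubK (both f) (pow2 phi m).
Proof.
have Pf := pow1_in m tf; have Pg k := pow1_in k tg.
have -> : ssubK (pow2 phibar) (pow1 f m) =
    ssubK (fun j => ssubK (both f) (ssubK (pow2 phi) (pow1 g j))) (pow1 f m).
  by apply: (@eq_ssub K _ _ _ _ K^o); exact: pow2_conj.
have aphig := admissible_comp sLP (admissible_pow1 tg) aphi.
rewrite -[LHS](ssubA (W := K^o) aphig (admissible_both0 tf) Pf).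
congr (ssubK _ _).
rewrite -[LHS](ssubA (W := K^o) (admissible_pow1 tg) aphi Pf).
rewrite -[pow2 phi m](ssubK_monom (pow2 phi)); congr (ssubK _ _).
exact: subst1_pow.
Qed.

End Conjugate.

(** Since f(phibar) = T(phi), substituting g(x), g(z) undoes T. Thus the functor defined by g
    returns to phi itself. *)
Lemma conj_associateK (f g : int -> K) (phi : int * int -> K) :
  tangent_to_id f -> tangent_to_id g ->
  subst1K f g = monom K 1 -> subst1K g f = monom K 1 -> tangent_to_fst phi ->
  conj_associate g f (conj_associate f g phi) = phi.
Proof.
move=> tf tg gf fg tphi; have tbar := conj_tangent tf tg gf tphi.
have [uphi _] := tangent_fst_unit tphi.
rewrite (conj_associateE tg tf tbar).
have := ssub_pow2_conj tf tg fg tphi 1; rewrite pow1_1 pow2_1 => ->.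
have -> : phi = pow2 phi 1 by rewrite pow2_1.
apply: (both_id (W := K^o) tg tf fg); apply: lex0_lex.
exact: (pow2_in 1 uphi).
Qed.

End Conjugation.

(** * Substitution for one of two variables *)

Section ProductKernels.
Variable K : fieldType.

(** Supports inside a rectangle: the two exponents are restricted independently, in contrast with
    [lex_family]. *)
Definition prod_family (M N : Type) (P : set (set M)) (Q : set (set N)) :
    set (set (M * N)) :=
  [set S | exists D E, [/\ P D, Q E & S `<=` D `*` E]].

(** The images of the two source variables are series in the same target variables and are
    multiplied there; in [tens] the target variables are separate. *)
Definition conv (M N : Type) (I : zmodType) (r : M -> I -> K) (s : N -> I -> K)
    (p : M * N) : I -> K :=
  smulK (r p.1) (s p.2).

Lemma prod_family_family (M N : zmodType) (P : set (set M)) (Q : set (set N)) :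
  support_family P -> support_family Q -> support_family (prod_family P Q).
Proof.
move=> sP sQ; split.
- exists [set 0], [set 0]; split; [exact: sfam0|exact: sfam0|by move=> p ->].
- move=> S T ST [D [E [PD QE TDE]]]; exists D, E; split=> //.
  exact: subset_trans TDE.
- move=> S T [D [E [PD QE SDE]]] [D' [E' [PD' QE' TDE]]].
  exists (D `|` D'), (E `|` E'); split; [exact: sfamU|exact: sfamU|].
  by move=> p [/SDE[]|/TDE[]]; split; by [left|right].
- move=> S T [D [E [PD QE SDE]]] [D' [E' [PD' QE' TDE]]].
  exists (sumset D D'), (sumset E E'); split; [exact: sfamD|exact: sfamD|].
  by move=> p [q /SDE[Dq Eq] /TDE[Dp Ep]]; split; [exists q.1|exists q.2].
- move=> S T [D [E [PD QE SDE]]] [D' [E' [PD' QE' TDE]]] p.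
  apply: sub_finite_set (finite_setX (sfam_dec sP PD PD' p.1)
                                     (sfam_dec sQ QE QE' p.2)) => q /=.
  by move=> [/SDE[Dq Eq] /TDE[Dp Ep]].
Qed.

Lemma admissible_conv (M N : Type) (I : zmodType) (P : set (set M))
    (Q : set (set N)) (R : set (set I)) (r : M -> I -> K) (s : N -> I -> K) :
  support_family R -> admissible r P R -> admissible s Q R ->
  admissible (conv r s) (prod_family P Q) R.
Proof.
move=> sR rPR sQR S [D [E [/rPR[Rr lr] /sQR[Rs ls] SDE]]].
have key m n i : S (m, n) -> conv r s (m, n) i != 0 -> exists j,
    [/\ D m, E n, r m j != 0 & s n (i - j) != 0].
  by move=> /SDE[/= Dm En] /supp_smul[j rj sj]; exists j.
split.
  apply: (sfamS sR) (sfamD sR Rr Rs) => i [[m n] Smn] /(key _ _ _ Smn).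
  by move=> [j [Dm En rj sj]]; exists j; [exists m|exists n].
move=> i; apply: (@sub_finite_set _ _ (\bigcup_(j in [set j | image_supp r D j /\
    image_supp s E (i - j)]) ([set m | D m /\ r m j != 0] `*`
                              [set n | E n /\ s n (i - j) != 0]))).
  move=> [m n] [Smn] /(key _ _ _ Smn)[j [Dm En rj sj]].
  by exists j => //=; split; [exists m|exists n].
apply: bigcup_finite => [|j _]; first exact: (sfam_dec sR Rr Rs).
exact: finite_setX.
Qed.

Lemma admissible_tens_prod (M N I J : Type) (P : set (set M)) (Q : set (set N))
    (P' : set (set I)) (Q' : set (set J)) (r : M -> I -> K) (s : N -> J -> K) :
  admissible r P P' -> admissible s Q Q' ->
  admissible (tens r s) (prod_family P Q) (prod_family P' Q').
Proof.
move=> rP sQ S [D [E [/rP[Pr lr] /sQ[Qs ls] SDE]]]; split.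
  exists (image_supp r D), (image_supp s E); split=> // -[i j] [[m n] /SDE[Dm En]].
  by rewrite mulf_eq0 negb_or => /andP[rm sn]; split; [exists m|exists n].
move=> [i j]; apply: sub_finite_set (finite_setX (lr i) (ls j)) => -[m n] /=.
by move=> [/SDE[/= Dm En]]; rewrite mulf_eq0 negb_or => /andP[rm sn].
Qed.

Lemma power_family_conv (M N I : zmodType) (P : set (set I)) (r : M -> I -> K)
    (s : N -> I -> K) :
  support_family P ->
  (forall m, series_in P (r m)) -> (forall n, series_in P (s n)) ->
  power_family r -> power_family s -> power_family (conv r s).
Proof.
move=> sP Pr Ps [r0 rD] [s0 sD]; split; first by rewrite /conv r0 s0 smulK1.
have PM := series_mul sP.
move=> [k m] [l n]; rewrite /conv /= rD sD.
rewrite !(series_mulA sP) //; try by apply: PM.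
by congr smulK; rewrite (series_mulCA sP) //; apply: PM.
Qed.

(** A series a(x1) b(x2) is the product of a(x1) and b(x2), each regarded as a series in two
    variables; multiplicativity then separates the two substitutions. *)
Lemma ssub_conv (P : set (set (int * int))) (I : zmodType) (Q : set (set I))
    (r s : int -> I -> K) (a b : int -> K) :
  support_family Q -> admissible (conv r s) P Q -> power_family (conv r s) ->
  r 0 = @sone K I -> s 0 = @sone K I ->
  P [set p | a p.1 != 0 /\ p.2 = 0] -> P [set p | p.1 = 0 /\ b p.2 != 0] ->
  ssubK (conv r s) (fun p => a p.1 * b p.2) = smulK (ssubK r a) (ssubK s b).
Proof.
move=> sQ acP pc r0 s0 Pa Pb; have [Qa la] := acP _ Pa; have [Qb lb] := acP _ Pb.
pose a1 (p : int * int) := a p.1 * monom K 0 p.2.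
pose b1 (p : int * int) := monom K 0 p.1 * b p.2.
have -> : (fun p => a p.1 * b p.2) = smulK a1 b1.
  apply/funext => -[m n].
  rewrite /smulK /smul (fsum1 (i := (m, 0))) => [|[k l] kl].
    by rewrite /a1 /b1 /monom /= subrr subr0 eqxx mulr1 mul1r.
  rewrite /a1 /b1 /monom /=; have [l0|_] := eqVneq l 0; last first.
    by rewrite mulr0 scale0r.
  have [/eqP|_] := eqVneq (m - k) 0; last by rewrite mul0r scaler0.
  by rewrite subr_eq0 => /eqP e; rewrite e l0 eqxx in kl.
have [_ pcD] := pc.
rewrite [LHS](@ssub_smul _ _ _ _ K^o _ _ _ _ _ _ la lb) //.
- congr smulK; apply/funext => i.
    rewrite /ssubK /ssub (fsum_fst (c := 0)) => [|[k l] /= l0].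
      apply: eq_fsbigr => k _.
      by rewrite /conv /= s0 smulKC smulK1 /a1 /monom eqxx mulr1.
    by rewrite /a1 /monom /= (negPf l0) mulr0 scaler0.
  rewrite /ssubK /ssub (fsum_snd (c := 0)) => [|[k l] /= l0].
    by apply: eq_fsbigr => k _; rewrite /conv /= r0 smulK1 /b1 /monom eqxx mul1r.
  by rewrite /b1 /monom /= (negPf l0) mul0r scaler0.
- move=> [m n]; rewrite /supp /= /a1 /= mulf_eq0 negb_or => /andP[am].
  by move=> /supp_monom.
- move=> [m n]; rewrite /supp /= /b1 /= mulf_eq0 negb_or => /andP[/supp_monom] //.
- exact: (sfam_dec sQ).
Qed.

End ProductKernels.

(* The supports of series in W((x, z)). *)
Notation LS2 := (prod_family bounded_below bounded_below).
Definition sLS2 := prod_family_family bounded_below_family bounded_below_family.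

Section SubstFst.
Variable K : fieldType.

Definition xmon (n : int) : int * int -> K := monom K (n, 0).

Lemma xmon_in n : series_in LP (xmon n).
Proof.
apply: (sfamS sLP (@supp_monom _ _ _)); split; first by move=> p ->.
by move=> k; exists n => i [->].
Qed.

Lemma admissible_xmon : admissible xmon FL LP.
Proof.
move=> D [N DN]; split.
  split=> [p [m _ /supp_monom ->]//|n].
  by exists N => i [m /DN + /supp_monom [->]].
move=> [i n]; apply: (@sub_finite_set _ _ [set i]); last exact: finite_set1.
by move=> m [_ /supp_monom [->]].
Qed.

Lemma smul_monomD (I : zmodType) (i j : I) :
  monom K (i + j) = smulK (monom K i) (monom K j).
Proof.
by apply/funext => k; rewrite /smulK smul_monom /monom subr_eq [j + i]addrC.
Qed.

Lemma power_family_xmon : power_family xmon.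
Proof. by split=> // k l; rewrite -smul_monomD /xmon; congr monom. Qed.

Lemma ssub_xmon (a : int -> K) : ssubK xmon a = fun p => a p.1 * monom K 0 p.2.
Proof.
apply/funext => -[i j]; rewrite /ssubK /ssub (fsum1 (i := i)) => [|k ki].
  by rewrite /xmon monom_pair /= {1}/monom eqxx mul1r; exact: mulrC.
by rewrite /xmon monom_pair /= {1}/monom eq_sym (negPf ki) mul0r scale0r.
Qed.

Section Kernel.
Variable phi : int * int -> K.
Hypothesis tphi : tangent_to_fst phi.

Let uphi : series_unit LP phi := (tangent_fst_unit tphi).1.
Let aphi : admissible (pow2 phi) FL LP := (tangent_fst_unit tphi).2.

(** Sends x1^m x2^n to phi(x2, x0)^m x2^n, with x2 written first among the target variables. *)
Definition fst_kernel : int * int -> int * int -> K := conv (pow2 phi) xmon.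

Lemma subst_fstE (W : lmodType K) (a : int * int -> W) :
  subst_fst phi a = ssub fst_kernel a.
Proof.
apply/funext => p; apply: eq_fsbigr => -[m n] _.
by rewrite /fst_kernel /conv smulKC /smulK smul_monom; case: p => i j /=;
   rewrite -[X in (_, X)]subr0.
Qed.

Lemma admissible_fst_kernel : admissible fst_kernel LS2 LP.
Proof. exact: (admissible_conv sLP aphi admissible_xmon). Qed.

Lemma power_family_fst_kernel : power_family fst_kernel.
Proof.
apply: (power_family_conv sLP).
- by move=> m; exact: pow2_in.
- exact: xmon_in.
- exact: power_family_pow2.
- exact: power_family_xmon.
Qed.

Lemma ssub_fst_kernel (a b : int -> K) : series_in FL a -> series_in FL b ->
  ssubK fst_kernel (fun p => a p.1 * b p.2) =
  smulK (ssubK (pow2 phi) a) (ssubK xmon b).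
Proof.
move=> Pa Pb; apply: (ssub_conv sLP admissible_fst_kernel power_family_fst_kernel).
- by case: (power_family_pow2 uphi).
- by case: power_family_xmon.
- exists (supp (a : int -> K^o)), [set 0]; split=> //.
  exact: (sfam0 sFL).
- exists [set 0], (supp (b : int -> K^o)); split=> //.
  exact: (sfam0 sFL).
Qed.

End Kernel.

Lemma laurent_series2E (W : lmodType K) (a : int * int -> W) :
  laurent_series2 a <-> LS2 (supp a).
Proof.
split=> [[N aN]|[D [E [[N DN] [N' EN] SDE]]]].
  exists [set m | N <= m], [set n | N <= n]; split; try by exists N.
  move=> [m n] amn; split; rewrite /= leNgt; apply: contra_neqN amn => h.
    by apply: aN; left.
  by apply: aN; right.
exists (Num.min N N') => m n mn; apply: contraPP mn => /eqP /SDE[/DN /= Nm /EN /= Nn].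
by rewrite !lt_min; lia.
Qed.

Lemma power_series2_LS2 (W : lmodType K) (a : int * int -> W) :
  power_series2 a -> LS2 (supp a).
Proof. by move=> a0; apply/laurent_series2E; exists 0. Qed.

Lemma power_series2_LP (W : lmodType K) (a : int * int -> W) :
  power_series2 a -> LP (supp a).
Proof.
move=> a0; split=> [[m n] amn|n].
  by rewrite leNgt; apply: contra_neqN amn => h; apply: a0; right.
by exists 0 => m amn; rewrite leNgt; apply: contra_neqN amn => h; apply: a0; left.
Qed.

Section Intertwining.
Variables (f g : int -> K) (phi : int * int -> K).
Hypotheses (tf : tangent_to_id f) (tg : tangent_to_id g).
Hypotheses (gf : subst1K f g = monom K 1) (fg : subst1K g f = monom K 1).
Hypothesis tphi : tangent_to_fst phi.
Local Notation phibar := (conj_associate f g phi).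
Let tbar : tangent_to_fst phibar := conj_tangent tf tg gf tphi.

Lemma admissible_both2 : admissible (both f) LS2 LS2.
Proof. by apply: admissible_tens_prod; exact: admissible_pow1. Qed.

(** On the monomial with exponents (m, n) both sides are f(phibar)^m f(x)^n, the left one because
    T(phi^m) = f(phibar)^m. *)
Lemma both_fst_kernel q :
  ssubK (both f) (fst_kernel phi q) = ssubK (fst_kernel phibar) (both f q).
Proof.
have [f0 _] := power_family_pow1 tf.
case: q => m n.
rewrite [RHS](ssub_fst_kernel tbar) //; try exact: pow1_in.
rewrite (ssub_pow2_conj tf tg fg tphi) ssub_xmon.
rewrite (ssubK_mul sLP (admissible_both0 tf) (power_family_both tf)).
- congr smulK; rewrite ssubK_monom; apply/funext => p.
  by rewrite -[monom K 0]/(@sone K int) -f0.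
- by apply: pow2_in; have [] := tangent_fst_unit tphi.
- exact: xmon_in.
Qed.

Lemma both_subst_fst (W : lmodType K) (a : int * int -> W) :
  laurent_series2 a ->
  ssub (both f) (subst_fst phi a) = subst_fst phibar (ssub (both f) a).
Proof.
move=> /laurent_series2E La; rewrite !subst_fstE.
rewrite (ssubA (admissible_fst_kernel tphi) (admissible_both0 tf) La).
rewrite (ssubA admissible_both2 (admissible_fst_kernel tbar) La).
by apply: eq_ssub; exact: both_fst_kernel.
Qed.

End Intertwining.

End SubstFst.

(** * Power series in two variables and divided differences *)

Section PowerSeries2.
Variable K : fieldType.
Implicit Types (f g : int -> K) (a b q : int * int -> K).

Lemma power_series2E (W : lmodType K) (a : int * int -> W) :
  power_series2 a <-> forall p, a p != 0 -> 0 <= p.1 /\ 0 <= p.2.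
Proof.
split=> [a0 [m n] amn|a0 m n mn].
  by split; rewrite leNgt; apply: contra_neqN amn => h; apply: a0; [left|right].
by apply: contraPP mn => /eqP /a0 [/= m0 n0]; lia.
Qed.

Lemma power_series2_one : power_series2 (@sone K _ : int * int -> K^o).
Proof. by apply/power_series2E => p /supp_monom ->. Qed.

Lemma power_series2_mul a b :
  power_series2 (a : int * int -> K^o) -> power_series2 (b : int * int -> K^o) ->
  power_series2 (smulK a b : int * int -> K^o).
Proof.
move=> /power_series2E a0 /power_series2E b0; apply/power_series2E => -[i j].
by move=> /supp_smul[[k l] /a0[/= k0 l0] /b0[/= ik jl]]; split; lia.
Qed.

Lemma power_series2_exp a n :
  power_series2 (a : int * int -> K^o) ->
  power_series2 (sexpn a n : int * int -> K^o).
Proof.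
move=> a0; elim: n => [|n IHn]; first exact: power_series2_one.
exact: power_series2_mul.
Qed.

Lemma power_series2_both f a : tangent_to_id f ->
  power_series2 (a : int * int -> K^o) ->
  power_series2 (ssubK (both f) a : int * int -> K^o).
Proof.
move=> /tangent_unit[_ fle] /power_series2E a0; apply/power_series2E => -[i j].
move=> /(@supp_ssub _ _ _ _ K^o)[[m n] /a0[/= m0 n0]].
rewrite mulf_eq0 negb_or => /andP[/fle mi /fle nj].
by split; [exact: le_trans mi|exact: le_trans nj].
Qed.

Lemma ssubK_sexpn (M I : zmodType) (P : set (set M)) (Q : set (set I))
    (r : M -> I -> K) (c : M -> K) n :
  support_family P -> support_family Q -> admissible r P Q ->
  power_family r -> series_in P c ->
  ssubK r (sexpn c n) = sexpn (ssubK r c) n.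
Proof.
move=> sP sQ rPQ rM Pc; elim: n => [|n IHn]; first exact: ssubK_one.
rewrite /sexpn /= -!/(sexpn _ n) (ssubK_mul sQ rPQ) ?IHn //.
exact: series_exp.
Qed.

Definition diff12 : int * int -> K :=
  fun p => monom K (1, 0) p - monom K (0, 1) p.

(** This is (g(x1) - g(x2)) / (x1 - x2): the quotient of x1^n - x2^n by x1 - x2 is the sum of x1^i
    x2^j over i + j = n - 1. *)
Definition divided_difference g : int * int -> K :=
  fun p => if (0 <= p.1) && (0 <= p.2) then g (p.1 + p.2 + 1) else 0.

Lemma power_series2_diff12 : power_series2 (diff12 : int * int -> K^o).
Proof.
apply/power_series2E => p; rewrite /diff12.
have [->//|p1] := eqVneq p (1, 0); have [->//|p2] := eqVneq p (0, 1).
by rewrite /monom (negPf p1) (negPf p2) subrr eqxx.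
Qed.

Lemma power_series2_divided g :
  power_series2 (divided_difference g : int * int -> K^o).
Proof.
apply/power_series2E => p; rewrite /divided_difference.
by have [/andP[]|] := boolP ((0 <= p.1) && (0 <= p.2)); rewrite ?eqxx.
Qed.

Lemma both_diff12 g : tangent_to_id g ->
  ssubK (both g) diff12 = fun p => g p.1 * monom K 0 p.2 - monom K 0 p.1 * g p.2.
Proof.
move=> tg; have [g0 _] := power_family_pow1 tg; have g1 := pow1_1 g.
have LPm p : 0 <= p.2 -> LP (supp (monom K p : int * int -> K^o)).
  move=> p0; apply: (sfamS sLP (@supp_monom _ _ _)); split; first by move=> ? ->.
  by move=> n; exists p.1 => i <-.
apply/funext => -[i j].
have := @ssub_linear K _ _ (both g) K^o (-1) (monom K (0, 1)) (monom K (1, 0)) (i, j).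
have [|_ lf1] := admissible_both0 tg (LPm (0, 1) _); first by [].
have [|_ lf2] := admissible_both0 tg (LPm (1, 0) _); first by [].
move=> /(_ (lf1 _) (lf2 _)) e.
have -> : diff12 = fun p => -1 *: (monom K (0, 1) p : K^o) + monom K (1, 0) p.
  by apply/funext => p; rewrite scaleN1r addrC.
rewrite [LHS]e -!/(ssubK (both g) _ _) !ssubK_monom scaleN1r addrC.
by rewrite /= -[monom K 0]/(@sone K int) -g0 -(congr1 (@^~ i) g1) -(congr1 (@^~ j) g1).
Qed.

Lemma diff12_divided g : tangent_to_id g ->
  smulK diff12 (divided_difference g) = ssubK (both g) diff12.
Proof.
move=> tg; have [gps g0 _] := tg; rewrite both_diff12 //.
have LPd := power_series2_LP (power_series2_divided g).
have LPm p : 0 <= p.2 -> LP (supp (monom K p : int * int -> K^o)).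
  move=> p0; apply: (sfamS sLP (@supp_monom _ _ _)); split; first by move=> ? ->.
  by move=> n; exists p.1 => i <-.
rewrite smulKBl; try by apply: (sfam_dec sLP) => //; exact: LPm.
apply/funext => -[i j]; rewrite /smulK !smul_monom /divided_difference /monom /=.
have gneg n : n < 0 -> g n = 0 by move=> n0; exact: gps.
rewrite !subr0 (_ : (0 <= i - 1) = (0 < i)); last by lia.
rewrite (_ : (0 <= j - 1) = (0 < j)); last by lia.
rewrite (_ : i - 1 + j + 1 = i + j); last by lia.
rewrite (_ : i + (j - 1) + 1 = i + j); last by lia.
(* Where i, j > 0 the two shifted coefficients g (i + j) cancel; only the axes survive, and g 0 = 0
   settles the origin. *)
have [i0|i0|->] := ltgtP i 0; have [j0|j0|->] := ltgtP j 0;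
  rewrite /= ?mulr0 ?mulr1 ?mul0r ?mul1r ?subr0 ?subrr ?addr0 ?add0r ?g0 //;
  by rewrite gneg ?oppr0.
Qed.

End PowerSeries2.

(** * Coordinated modules *)

Section Maps.
Variable K : fieldType.
Implicit Types (V W : lmodType K) (f : int -> K).

Lemma vertex_map_subst V W f (Y : V -> W -> int -> W) :
  tangent_to_id f -> vertex_map Y -> vertex_map (Ysubst f Y).
Proof.
move=> tf [Yl Yr YL].
have lf v w := (admissible_pow1 tf (proj1 (laurent_seriesE _) (YL v w))).2.
split=> [w n c v v'|v n c w w'|v w].
- rewrite /Ysubst -ssub_linear; [|exact: lf|exact: lf].
  by congr (ssub _ _ n); apply/funext => m; exact: Yl.
- rewrite /Ysubst -ssub_linear; [|exact: lf|exact: lf].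
  by congr (ssub _ _ n); apply/funext => m; exact: Yr.
- apply/laurent_seriesE/(sfam_ssub sFL (admissible_pow1 tf)).
  exact/laurent_seriesE.
Qed.

Section Double.
Variables (V W : lmodType K) (f : int -> K).
Variables (h : int -> V -> W) (x : int -> V).
Hypotheses (tf : tangent_to_id f) (hl : forall m, linear (h m)).
Hypotheses (xL : FL (supp x)) (hL : forall n, FL (supp (fun m => h m (x n)))).

(** The common shape of Y(u, x1) Y(v, x2) w and Y(Y(u, x0) v, x2) w: a linear family of series
    applied to each coefficient of a Laurent series. The order in the first variable depends on that
    coefficient, so the support is in F2 but in general not in a rectangle. *)
Lemma double_F2 : F2 (supp (fun p => h p.1 (x p.2))).
Proof.
have h0 m : h m 0 = 0 by have := hl m (-1) 0 0; rewrite scaler0 add0r scaleN1r addNr.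
case: xL => N xN; split; last exact: hL.
exists N => -[m n]; rewrite /supp /= => hmn; apply: xN.
by apply: contraNneq hmn => ->; rewrite h0.
Qed.

(** Linearity of each [h m] lets the inner substitution of f pass through it, so substituting in
    both variables amounts to replacing the two fields by their substituted versions. *)
Lemma both_double :
  ssub (both f) (fun p => h p.1 (x p.2)) =
  fun p => ssub (pow1 f) (fun m => h m (ssub (pow1 f) x p.2)) p.1.
Proof.
apply/funext => -[i j] /=.
have [_ lf] := admissible_pow1 tf xL.
have [_ lf2] := admissible_both tf double_F2.
transitivity (\sum_(m \in [set: int]) \sum_(n \in [set: int])
    (pow1 f m i * pow1 f n j) *: h m (x n)).
  rewrite (fsum_pair (F := fun m n => (pow1 f m i * pow1 f n j) *: h m (x n))) //.
  apply: sub_finite_set (lf2 (i, j)) => -[m n] /=.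
  by rewrite scaler_eq0 negb_or => /andP[].
apply: eq_fsbigr => m _; rewrite (linear_ssub (hl m) (lf j)) /ssub fsum_scaler.
by apply: eq_fsbigr => n _; rewrite scalerA.
Qed.

End Double.

End Maps.

(** * Transport of coordinated modules *)

Section Modules.
Variables (K : fieldType) (f g : int -> K) (phi : int * int -> K).
Hypotheses (tf : tangent_to_id f) (tg : tangent_to_id g).
Hypotheses (gf : subst1K f g = monom K 1) (fg : subst1K g f = monom K 1).
Hypothesis tphi : tangent_to_fst phi.
Local Notation phibar := (conj_associate f g phi).
Let tbar : tangent_to_fst phibar := conj_tangent tf tg gf tphi.

(** The factor c brings the transformed multiplier back into the class Q; c' recovers the
    transformed multiplier, so that multiplying by c cannot make it vanish at x1 = phibar(x2,
    x0). *)
Definition subst_stable (Q : set (int * int -> K)) : Prop :=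
  forall q, Q q -> power_series2 (q : int * int -> K^o) ->
  exists c c' : int * int -> K,
    [/\ power_series2 (c : int * int -> K^o), power_series2 (c' : int * int -> K^o),
        Q (smulK c (ssubK (both f) q)) &
        smulK c' (smulK c (ssubK (both f) q)) = ssubK (both f) q].

Lemma all_series_stable : subst_stable all_series.
Proof.
move=> q _ q0; exists (@sone K _), (@sone K _).
by split=> //; try exact: power_series2_one; rewrite !smulK1.
Qed.

(** Both factors are powers of divided differences, of g (after T) for c and of f for c', so no
    inverse of a power series has to be constructed. *)
Lemma diff_powers_stable : subst_stable diff_powers.
Proof.
move=> q [k ->] _; rewrite -/(diff12 K).
have LPd := power_series2_LP (@power_series2_diff12 K).
have PSU := @power_series2_divided K.
pose c := ssubK (both f) (divided_difference g).
have PSc : power_series2 (c : int * int -> K^o) by exact: power_series2_both.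
have LPc : series_in LP c by exact: power_series2_LP.
have LPD : series_in LP (ssubK (both f) (@diff12 K)).
  exact: (series_ssub sLP (admissible_both0 tf) LPd).
(* c = (x1 - x2) / (f(x1) - f(x2)), as x_i = g(f(x_i)) *)
have cD : smulK c (ssubK (both f) (@diff12 K)) = @diff12 K.
  rewrite smulKC -(ssubK_mul sLP (admissible_both0 tf) (power_family_both tf)) //.
    rewrite diff12_divided //; apply: (both_id (W := K^o) tf tg gf).
    exact: lex0_lex.
  exact: power_series2_LP.
have e : ssubK (both f) (sexpn (@diff12 K) k) = sexpn (ssubK (both f) (@diff12 K)) k.
  exact: (ssubK_sexpn k sLP sLP (admissible_both0 tf) (power_family_both tf)).
have ck : smulK (sexpn c k) (ssubK (both f) (sexpn (@diff12 K) k)) =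
          sexpn (@diff12 K) k.
  by rewrite e -(series_expM sLP) // cD.
exists (sexpn c k), (sexpn (divided_difference f) k); rewrite ck; split.
- exact: power_series2_exp.
- exact: power_series2_exp.
- by exists k.
- rewrite -(series_expM sLP) //; last exact: power_series2_LP.
  by rewrite smulKC diff12_divided.
Qed.

Lemma coordinated_module_subst (Q : set (int * int -> K)) (V : lmodType K)
    (Y : V -> V -> int -> V) (vac : V) (W : lmodType K) (YW : V -> W -> int -> W) :
  subst_stable Q -> vertex_map Y -> coordinated_module Q phi Y vac YW ->
  coordinated_module Q phibar (Ysubst f Y) vac (Ysubst f YW).
Proof.
move=> HQ [Yl Yr YL] [[YWl YWr YWL] Yvac assoc].
have [f0 _] := power_family_pow1 tf.
split.
- exact: vertex_map_subst.
- move=> w n; rewrite /Ysubst /subst1 (fsum1 (i := 0)) => [|m m0].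
    by rewrite Yvac eqxx f0 /sone /monom; case: (n == 0); rewrite ?scale1r ?scale0r.
  by rewrite Yvac (negPf m0) scaler0.
move=> u v; have [q [PSq Qq qne Lq eqq]] := assoc u v.
have [c [c' [PSc PSc' Qc c'c]]] := HQ _ Qq PSq.
pose Tq := ssubK (both f) q; pose q' := smulK c Tq.
have PSTq : power_series2 (Tq : int * int -> K^o) by exact: power_series2_both.
have PSq' : power_series2 (q' : int * int -> K^o) by exact: power_series2_mul.
(* Only the product with q lies in W((x1, x2)). The bare product lies in W((x1))((x2)), which is
   where T is shown to be multiplicative on it. *)
have prodF2 w : F2 (supp (Yprod YW u v w)).
  apply: (double_F2 (h := fun m a => YW u a m) (x := YW v w)) => [m||n].
  - exact: YWr.
  - exact/laurent_seriesE.
  - exact/laurent_seriesE.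
have prodE w : ssub (both f) (Yprod YW u v w) = Yprod (Ysubst f YW) u v w.
  apply: (both_double (h := fun m a => YW u a m) (x := YW v w) tf) => [m||n].
  - exact: YWr.
  - exact/laurent_seriesE.
  - exact/laurent_seriesE.
pose R w (p : int * int) := YW (Y u v p.2) w p.1.
have RF2 w : F2 (supp (R w)).
  apply: (double_F2 (h := fun m a => YW a w m) (x := Y u v)) => [m||n].
  - exact: YWl.
  - exact/laurent_seriesE.
  - exact/laurent_seriesE.
have RE w : ssub (both f) (R w) =
    fun p => Ysubst f YW (Ysubst f Y u v p.2) w p.1.
  apply: (both_double (h := fun m a => YW a w m) (x := Y u v) tf) => [m||n].
  - exact: YWl.
  - exact/laurent_seriesE.
  - exact/laurent_seriesE.
(* The substitution x1 = phibar(x2, x0) is split off only from a power series times an element of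
   X((x1, x2)); hence c is separated from T(q Y_W Y_W) as a whole, not from Y_W Y_W. *)
have kmul (X : lmodType K) (a : int * int -> K) (b : int * int -> X) :
    power_series2 (a : int * int -> K^o) -> LS2 (supp b) ->
    subst_fst phibar (smul a b) = smul (subst_fstK phibar a) (subst_fst phibar b).
  move=> PSa Lb; rewrite /subst_fstK !subst_fstE.
  rewrite (ssub_mul sLP (admissible_fst_kernel tbar) (power_family_fst_kernel tbar)) //.
  exact: power_series2_LS2.
have F2q : series_in F2 q by exact/lex0_lex/power_series2_LP.
have F2Tq : series_in F2 Tq by exact/lex0_lex/power_series2_LP.
have F2c : series_in F2 c by exact/lex0_lex/power_series2_LP.
have TqE w : ssub (both f) (smul q (Yprod YW u v w)) =
             smul Tq (Yprod (Ysubst f YW) u v w).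
  by rewrite (ssub_mul sF2 (admissible_both tf) (power_family_both tf)) // prodE.
have TL w : LS2 (supp (smul Tq (Yprod (Ysubst f YW) u v w))).
  rewrite -TqE; apply: (sfam_ssub sLS2 (admissible_both2 tf)).
  exact/laurent_series2E.
have prodF2' w : F2 (supp (Yprod (Ysubst f YW) u v w)).
  by rewrite -prodE; exact: (sfam_ssub sF2 (admissible_both tf)).
have q'E w : smul q' (Yprod (Ysubst f YW) u v w) =
             smul c (smul Tq (Yprod (Ysubst f YW) u v w)).
  by rewrite (sfam_smulA sF2).
have kq : subst_fstK phibar Tq = ssubK (both f) (subst_fstK phi q).
  apply/esym; apply: (both_subst_fst (W := K^o) tf tg gf fg tphi).
  exact/laurent_series2E/power_series2_LS2.
have F2k psi (a : int * int -> K) : tangent_to_fst psi ->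
    power_series2 (a : int * int -> K^o) -> series_in F2 (subst_fstK psi a).
  move=> tpsi PSa; rewrite /subst_fstK subst_fstE; apply: lex0_lex.
  apply: (series_ssub sLP (admissible_fst_kernel tpsi)).
  exact: power_series2_LS2.
have kq' : subst_fstK phibar q' = smulK (subst_fstK phibar c) (subst_fstK phibar Tq).
  exact: (kmul K^o c Tq PSc (power_series2_LS2 PSTq)).
exists q'; split=> //.
(* Multiplying by c' shows that T(q) vanishes at phibar; this value is T applied to q(phi(x2, x0),
   x2), and T is injective with inverse the substitution of g. *)
- move=> kq'0; apply: qne.
  have kT0 : subst_fstK phibar Tq = fun=> 0.
    rewrite -[Tq]c'c; apply: etrans (kmul K^o c' q' PSc' (power_series2_LS2 PSq')) _.
    have -> : subst_fst phibar (q' : int * int -> K^o) = fun=> 0 := kq'0.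
    by apply/funext => i; rewrite /smul fsbig1 // => j _; rewrite scaler0.
  have e := both_id (W := K^o) tg tf fg (F2k _ _ tphi PSq).
  rewrite -[LHS]e (_ : ssub (both f) _ = fun=> 0); last by rewrite -kT0 kq.
  by apply/funext => i; rewrite /ssub fsbig1 // => j _; rewrite scaler0.
- move=> w; rewrite q'E; apply/laurent_series2E.
  apply: (sfam_smul sLS2) => //; exact: power_series2_LS2.
(* The left side is c at phibar times T of the axiom for q; T splits over the right side of that
   axiom, and the value of T(q) at phibar joins that of c to give q'. *)
- move=> w; rewrite q'E kmul // -TqE -(both_subst_fst tf tg gf fg tphi) //.
  rewrite eqq -/(R w) (ssub_mul sF2 (admissible_both tf) (power_family_both tf)) //.
  rewrite RE -/(subst_fstK phi q) -kq kq' (sfam_smulA sF2) //; try exact: F2k.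
    by rewrite -RE; exact: (sfam_ssub sF2 (admissible_both tf)).
  exact: F2k.
Qed.

End Modules.

(** * Isomorphisms of categories of modules *)

(** The types of [fmor T h] and [h] agree only after the object map has been identified with the
    identity, hence [JMeq] in the hypothesis. *)
Lemma functor_eq_id (C : category) (T : functor C C) :
  (forall A, T A = A) ->
  (forall A B (h : mor A B), JMeq (fmor T h) h) -> T = functor_id C.
Proof.
case: T => TO TM T1 TD /= /funext TOE; have {}TOE : TO = id by [].
subst TO => TME.
have e : TM = fun _ _ => id.
  apply: functional_extensionality_dep => A; apply: functional_extensionality_dep => B.
  by apply/funext => h; apply: JMeq_eq; exact: TME.
subst TM; rewrite /functor_id; congr Functor; exact: Prop_irrelevance.
Qed.

Section Objects.
Variables (K : fieldType) (Q : set (int * int -> K)) (V : lmodType K) (vac : V).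
Variables (phi : int * int -> K) (Y : V -> V -> int -> V).

Lemma cmodule_eq (W : lmodType K) (YW YW' : V -> W -> int -> W)
    (a : coordinated_module Q phi Y vac YW) (a' : coordinated_module Q phi Y vac YW') :
  YW = YW' -> CModule a = CModule a'.
Proof. by move=> e; subst YW'; congr CModule; exact: Prop_irrelevance. Qed.

(** The underlying spaces are literally the same. Once the structure maps are identified, the module
    axioms agree by proof irrelevance and a morphism is determined by its underlying map. *)
Lemma cmod_hom_JMeq (W X : lmodType K) (YW YW' : V -> W -> int -> W)
    (YX YX' : V -> X -> int -> X)
    (a : coordinated_module Q phi Y vac YW) (a' : coordinated_module Q phi Y vac YW')
    (b : coordinated_module Q phi Y vac YX) (b' : coordinated_module Q phi Y vac YX')
    (h : cmod_hom (CModule a) (CModule b)) (h' : cmod_hom (CModule a') (CModule b')) :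
  YW = YW' -> YX = YX' -> sval h = sval h' -> JMeq h h'.
Proof.
move=> eW eX; subst YW' YX'.
have ea : a = a' by exact: Prop_irrelevance.
have eb : b = b' by exact: Prop_irrelevance.
subst a' b' => e.
have -> : h = h' by case: h h' e => [h hP] [h' hP'] /= e; exact: eq_exist.
exact: JMeq_refl.
Qed.

End Objects.

Section Isomorphism.
Variables (K : fieldType) (f g : int -> K) (phi : int * int -> K).
Hypotheses (tf : tangent_to_id f) (tg : tangent_to_id g).
Hypotheses (gf : subst1K f g = monom K 1) (fg : subst1K g f = monom K 1).
Hypothesis tphi : tangent_to_fst phi.
Local Notation phibar := (conj_associate f g phi).

Lemma Ysubst_cancel (k l : int -> K) (V W : lmodType K) (Y : V -> W -> int -> W) :
  tangent_to_id k -> tangent_to_id l -> subst1K k l = monom K 1 ->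
  vertex_map Y -> Ysubst k (Ysubst l Y) = Y.
Proof.
move=> tk tl lk [_ _ YL]; apply/funext => v; apply/funext => w.
by rewrite /Ysubst subst1K_id.
Qed.

Lemma subst_isomorphismP (Q : set (int * int -> K)) (V : lmodType K)
    (Y : V -> V -> int -> V) (vac : V) :
  subst_stable f Q -> subst_stable g Q -> vertex_map Y ->
  subst_isomorphism Q vac f phi phibar Y (Ysubst f Y).
Proof.
move=> Qf Qg Ymap; have tbar := conj_tangent tf tg gf tphi.
have HO : subst_preserves_modules Q vac f phi phibar Y (Ysubst f Y).
  by move=> W YW; exact: coordinated_module_subst.
(* Conjugating phibar by g gives phi back, and substituting g(x) in Y_F gives Y back, so the same
   transport with f and g exchanged ends in the original category. *)
have HO' : subst_preserves_modules Q vac g phibar phi (Ysubst f Y) Y.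
  move=> W YW /(coordinated_module_subst tg tf fg gf tbar Qg).
  rewrite conj_associateK // Ysubst_cancel //; apply.
  exact: vertex_map_subst.
have morP (k : int -> K) (psi : int * int -> K) (X : V -> V -> int -> V)
    (tk : tangent_to_id k) : subst_preserves_morphisms Q vac k psi X.
  move=> M N theta [tl tY]; split=> // v w n; rewrite /Ysubst /subst1.
  have [_ _ YL] := cmod_map (cmod_axioms M).
  have [_ lf] := admissible_pow1 tk (proj1 (laurent_seriesE _) (YL v w)).
  have := linear_ssub tl (lf n); rewrite /ssub => ->.
  by apply: eq_fsbigr => m _; rewrite tY.
exists HO, (morP f phi Y tf), (subst_functor HO' (morP g phibar (Ysubst f Y) tg)).
split; apply: functor_eq_id.
- move=> [W YW a] /=; apply: cmodule_eq.
  by apply: Ysubst_cancel => //; exact: cmod_map a.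
- move=> [W YW a] [X YX b] h; apply: cmod_hom_JMeq => //.
    by apply: Ysubst_cancel => //; exact: cmod_map a.
  by apply: Ysubst_cancel => //; exact: cmod_map b.
- move=> [W YW a] /=; apply: cmodule_eq.
  by apply: Ysubst_cancel => //; exact: cmod_map a.
- move=> [W YW a] [X YX b] h; apply: cmod_hom_JMeq => //.
    by apply: Ysubst_cancel => //; exact: cmod_map a.
  by apply: Ysubst_cancel => //; exact: cmod_map b.
Qed.

End Isomorphism.

(** * Vertex algebras over a formal group *)

Section Reindexing.
Variable K : fieldType.

Lemma smul_reindex (I J : zmodType) (h : J -> I) (W : lmodType K) (a : I -> K)
    (b : I -> W) :
  bijective h -> (forall x y, h (x - y) = h x - h y) ->
  smul (a \o h) (b \o h) = smul a b \o h.
Proof.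
move=> bh hB; apply/funext => j; rewrite /smul /= (@reindex_fsbigT _ _ _ _ _ h _ bh).
by apply: eq_fsbigr => k _; rewrite /= hB.
Qed.

Definition swap (p : int * int) := (p.2, p.1).

Lemma swapK : involutive swap. Proof. by case. Qed.

Lemma swap_bij : bijective swap. Proof. by exists swap; exact: swapK. Qed.

Lemma smul_swap (W : lmodType K) (a : int * int -> K) (b : int * int -> W) :
  smul (a \o swap) (b \o swap) = smul a b \o swap.
Proof. by apply: smul_reindex => //; exact: swap_bij. Qed.

Lemma ssub_both_swap (f : int -> K) (W : lmodType K) (a : int * int -> W) :
  ssub (both f) (a \o swap) = ssub (both f) a \o swap.
Proof.
apply/funext => p; rewrite /ssub /= (@reindex_fsbigT _ _ _ _ _ swap _ swap_bij).
by apply: eq_fsbigr => q _; rewrite /= swapK /both /tens mulrC.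
Qed.

Lemma swap_inj (X : Type) (a b : int * int -> X) : a \o swap = b \o swap -> a = b.
Proof.
move=> ab; apply/funext => p.
by have := congr1 (@^~ (swap p)) ab; rewrite /= swapK.
Qed.

Lemma power_series2_swap (a : int * int -> K) :
  power_series2 (a : int * int -> K^o) ->
  power_series2 (a \o swap : int * int -> K^o).
Proof. by move=> a0 m n [] h; apply: a0; [right|left]. Qed.

Lemma power_series2_F2 (a : int * int -> K) :
  power_series2 (a : int * int -> K^o) -> series_in F2 a.
Proof. by move=> /power_series2_LP/lex0_lex. Qed.

(* In the associativity axiom the right-hand side Y(Y(u, x0)v, x2)w lies in
   V((x2))((x0)), so that its support is in F2 only after exchanging the
   variables. *)
Lemma smulA_swap (W : lmodType K) (a b : int * int -> K) (c : int * int -> W) :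
  power_series2 (a : int * int -> K^o) -> power_series2 (b : int * int -> K^o) ->
  F2 (supp (c \o swap)) -> smul (smulK a b) c = smul a (smul b c).
Proof.
move=> /power_series2_swap/power_series2_F2 a0.
move=> /power_series2_swap/power_series2_F2 b0 Fc.
apply: swap_inj.
rewrite -!smul_swap -(sfam_smulA sF2 a0 b0 Fc); congr smul.
exact/esym/(@smul_swap K^o).
Qed.

(** T treats the two variables alike and so commutes with exchanging them; this carries
    multiplicativity from W((x))((z)) over to W((z))((x)). *)
Lemma both_mul_swap (f : int -> K) (W : lmodType K) (a : int * int -> K)
    (b : int * int -> W) :
  tangent_to_id f -> power_series2 (a : int * int -> K^o) ->
  F2 (supp (b \o swap)) ->
  ssub (both f) (smul a b) = smul (ssubK (both f) a) (ssub (both f) b).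
Proof.
move=> tf /power_series2_swap/power_series2_F2 a0 Fb.
apply: swap_inj.
rewrite -ssub_both_swap -!smul_swap.
rewrite (ssub_mul sF2 (admissible_both tf) (power_family_both tf)) //.
by rewrite -ssub_both_swap; congr smul; exact: (@ssub_both_swap f K^o).
Qed.

End Reindexing.

(** * Substituting F(x0, x2) for the first variable *)

Section SubstSnd.
Variable K : fieldType.

Definition zmon (n : int) : int * int -> K := monom K (0, n).

Lemma zmon_in n : series_in F2 (zmon n).
Proof.
apply: (sfamS sF2 (@supp_monom _ _ _)); split; first by exists n => p ->.
by move=> k; exists 0 => i [->].
Qed.

Lemma power_family_zmon : power_family zmon.
Proof. by split=> // k l; rewrite -smul_monomD. Qed.

Lemma ssub_zmon (a : int -> K) : ssubK zmon a = fun p => monom K 0 p.1 * a p.2.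
Proof.
apply/funext => -[i j]; rewrite /ssubK /ssub (fsum1 (i := j)) => [|k ki].
  by rewrite /zmon monom_pair /= {2}/monom eqxx mulr1.
by rewrite /zmon monom_pair /= {2}/monom eq_sym (negPf ki) mulr0 scale0r.
Qed.

(** Sends x1^m x2^n to F(x0, x2)^m x2^n: the retained variable is now the one in which F is expanded
    in nonnegative powers. *)
Definition snd_kernel (F : int * int -> K) : int * int -> int * int -> K :=
  conv (pow2 F) zmon.

Lemma snd_kernelE (F : int * int -> K) m n i j :
  snd_kernel F (m, n) (i, j) = pow2 F m (i, j - n).
Proof.
rewrite /snd_kernel /conv smulKC /smulK smul_monom.
by congr (pow2 F m); congr pair; rewrite /= subr0.
Qed.

Lemma Yprod_atE (F : int * int -> K) (V W : lmodType K) (Y : V -> W -> int -> W)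
    u v w : Yprod_at F Y u v w = ssub (snd_kernel F) (Yprod Y u v w).
Proof.
apply/funext => p; apply: eq_fsbigr => -[m n] _.
by case: p => i j; rewrite snd_kernelE.
Qed.

Section Kernel.
Variable F : int * int -> K.
Hypothesis tF : tangent_to_fst F.

Let uF : series_unit LP F := (tangent_fst_unit tF).1.
Let aF : admissible (pow2 F) FL LP := (tangent_fst_unit tF).2.

Lemma admissible_snd_kernel : admissible (snd_kernel F) F2 F2.
Proof.
have F0 m i n : pow2 F m (i, n) != 0 -> 0 <= n.
  by have [h _] := pow2_in m uF => /h.
move=> D [[N DN] Dn]; split; last first.
  move=> [i b]; apply: (@sub_finite_set _ _ (\bigcup_(n in [set n | N <= n <= b])
      ((pair^~ n) @` [set m | D (m, n) /\ pow2 F m (i, b - n) != 0]))).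
    move=> [m n] [Dmn]; rewrite snd_kernelE => Fm.
    exists n; last by exists m.
    by have := DN _ Dmn; have := F0 _ _ _ Fm; rewrite /=; lia.
  apply: bigcup_finite => [|n _]; first exact: finite_int_interval.
  by apply: finite_image; have [_] := aF (Dn n); apply.
split.
  exists N => -[i b] [[m n] Dmn]; rewrite snd_kernelE => /F0.
  by have := DN _ Dmn; rewrite /=; lia.
move=> b; apply: (sfamS sFL _ (sfam_bigcup sFL (finite_int_interval N b)
  (G := fun n => [set i | image_supp (pow2 F) [set m | D (m, n)] (i, b - n)]) _)).
  move=> i [[m n] Dmn]; rewrite snd_kernelE => Fm.
  exists n; last by exists m.
  by have := DN _ Dmn; have := F0 _ _ _ Fm; rewrite /=; lia.
by move=> n _; have [[_ h] _] := aF (Dn n); exact: h.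
Qed.

Lemma power_family_snd_kernel : power_family (snd_kernel F).
Proof.
apply: (power_family_conv sF2).
- by move=> m; apply/lex0_lex/pow2_in.
- exact: zmon_in.
- exact: power_family_pow2.
- exact: power_family_zmon.
Qed.

Lemma ssub_snd_kernel (a b : int -> K) : series_in FL a -> series_in FL b ->
  ssubK (snd_kernel F) (fun p => a p.1 * b p.2) =
  smulK (ssubK (pow2 F) a) (ssubK zmon b).
Proof.
move=> Pa Pb; apply: (ssub_conv sF2 admissible_snd_kernel power_family_snd_kernel).
- by case: (power_family_pow2 uF).
- by case: power_family_zmon.
- split; first by exists 0 => p [_ ->].
  by move=> n; apply: (sfamS sFL) Pa => i [].
- case: Pb => N bN; split; first by exists N => p [_ /bN].
  by move=> n; exists 0 => i [/= ->].
Qed.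

End Kernel.

Section Intertwining.
Variables (f g : int -> K) (F : int * int -> K).
Hypotheses (tf : tangent_to_id f) (tg : tangent_to_id g).
Hypotheses (gf : subst1K f g = monom K 1) (fg : subst1K g f = monom K 1).
Hypothesis tF : tangent_to_fst F.
Local Notation Fbar := (conj_associate f g F).
Let tbar : tangent_to_fst Fbar := conj_tangent tf tg gf tF.

Lemma both_snd_kernel q :
  ssubK (both f) (snd_kernel F q) = ssubK (snd_kernel Fbar) (both f q).
Proof.
have [f0 _] := power_family_pow1 tf.
case: q => m n.
rewrite [RHS](ssub_snd_kernel tbar) //; try exact: pow1_in.
rewrite (ssub_pow2_conj tf tg fg tF) ssub_zmon.
rewrite (ssubK_mul sF2 (admissible_both tf) (power_family_both tf)).
- congr smulK; rewrite ssubK_monom; apply/funext => p.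
  by rewrite -[monom K 0]/(@sone K int) -f0.
- by apply/lex0_lex/pow2_in; have [] := tangent_fst_unit tF.
- exact: zmon_in.
Qed.

Lemma both_subst_snd (W : lmodType K) (a : int * int -> W) :
  F2 (supp a) ->
  ssub (both f) (ssub (snd_kernel F) a) = ssub (snd_kernel Fbar) (ssub (both f) a).
Proof.
move=> Fa; rewrite (ssubA (admissible_snd_kernel tF) (admissible_both tf) Fa).
rewrite (ssubA (admissible_both tf) (admissible_snd_kernel tbar) Fa).
by apply: eq_ssub; exact: both_snd_kernel.
Qed.

End Intertwining.

End SubstSnd.

(** * A formal group and its logarithm *)

Section FormalGroupLog.
Variables (K : fieldType) (F : int * int -> K) (f g : int -> K).
Hypotheses (FG : formal_group F) (logF : is_log F f) (invf : comp_inverse f g).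

Lemma tangent_log : tangent_to_id f. Proof. by case: logF. Qed.

(** Comparing coefficients of x in g(f(x)) = x: only the linear term of g contributes, since f^m
    starts at x^m. *)
Lemma tangent_log_inverse : tangent_to_id g.
Proof.
have tf := tangent_log; have [gps g0 gf _] := invf; split=> //.
have := congr1 (@^~ 1) gf; rewrite /subst1K /subst1 (fsum1 (i := 1)) => [|m m1].
  by rewrite pow1_1 /monom eqxx; case: tf => _ _ ->; rewrite scale1r.
have [m0|m0] := ltP m 0; first by rewrite gps ?scaler0.
have [->|m0'] := eqVneq m 0; first by rewrite g0 scaler0.
have [_ fle] := tangent_unit tf.
have [->|/fle m_le] := eqVneq (pow1 f m 1) 0; first by rewrite scale0r.
lia.
Qed.

Lemma power_series2_formal_group : power_series2 (F : int * int -> K^o).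
Proof. by case: FG. Qed.

Lemma tangent_formal_group : tangent_to_fst F.
Proof.
have [F0 F1 _ _] := FG; split=> //.
by apply/laurent_powerE; exact: power_series2_LP.
Qed.

Lemma power_series2_Fadd : power_series2 (Fadd K : int * int -> K^o).
Proof.
apply/power_series2E => p; rewrite /Fadd.
have [->//|p1] := eqVneq p (1, 0); have [->//|p2] := eqVneq p (0, 1).
by rewrite /monom (negPf p1) (negPf p2) addr0 eqxx.
Qed.

Lemma tangent_Fadd : tangent_to_fst (Fadd K).
Proof.
split; first by apply/laurent_powerE/power_series2_LP/power_series2_Fadd.
by move=> m; rewrite /Fadd !monom_pair /= {2 4}/monom /= mulr0 addr0 mulr1.
Qed.

Lemma both_Fadd :
  ssubK (both f) (Fadd K) = fun p => f p.1 * monom K 0 p.2 + monom K 0 p.1 * f p.2.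
Proof.
have tf := tangent_log; have [f0 _] := power_family_pow1 tf; have f1 := pow1_1 f.
have LPm p : 0 <= p.2 -> LP (supp (monom K p : int * int -> K^o)).
  move=> p0; apply: (sfamS sLP (@supp_monom _ _ _)); split; first by move=> ? ->.
  by move=> n; exists p.1 => i <-.
apply/funext => -[i j].
have := @ssub_linear K _ _ (both f) K^o 1 (monom K (1, 0)) (monom K (0, 1)) (i, j).
have [|_ lf1] := admissible_both0 tf (LPm (0, 1) _); first by [].
have [|_ lf2] := admissible_both0 tf (LPm (1, 0) _); first by [].
move=> /(_ (lf2 _) (lf1 _)) e.
have -> : Fadd K = fun p => 1 *: (monom K (1, 0) p : K^o) + monom K (0, 1) p.
  by apply/funext => p; rewrite scale1r.
rewrite [LHS]e -!/(ssubK (both f) _ _) !ssubK_monom scale1r.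
rewrite /= -[monom K 0]/(@sone K int) -f0.
by rewrite -(congr1 (@^~ i) f1) -(congr1 (@^~ j) f1).
Qed.

Lemma log_formal_group : ssubK (pow2 F) f = ssubK (both f) (Fadd K).
Proof.
rewrite both_Fadd; apply/funext => -[a b]; have [_ _ _ h] := logF.
by rewrite -[RHS]h; apply: eq_fsbigr => m _; exact: mulrC.
Qed.

(** Apply g to f(F(x, y)) = f(x) + f(y). *)
Lemma formal_group_conj : F = conj_associate f g (Fadd K).
Proof.
have tF := tangent_formal_group; have [uF aF] := tangent_fst_unit tF.
have tf := tangent_log; have [uf _] := tangent_unit tf.
have [_ _ gf _] := invf.
have Pg : FL (supp (g : int -> K^o)).
  by rewrite -(pow1_1 g); exact: (pow1_in 1 tangent_log_inverse).
have e m : pow2 (subst_both f (Fadd K)) m = ssubK (pow2 F) (pow1 f m).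
  rewrite subst_bothE -log_formal_group pow2E pow1E.
  by rewrite (ssubK_sexpz sLP aF sFL (power_family_pow2 uF)).
transitivity (ssubK (fun m => ssubK (pow2 F) (pow1 f m)) g); last first.
  by apply/funext => p; apply: eq_fsbigr => m _; rewrite e; exact: mulrC.
rewrite -[RHS](ssubA (W := K^o) (admissible_pow1 tf) aF Pg).
rewrite -/(ssubK _ _) -[ssub (pow1 f) _]/(subst1K f g) gf.
by rewrite ssubK_monom pow2_1.
Qed.

(** With psi = f(x) + f(y) one has F = g(psi), and x divides g(x). This turns an identity multiplied
    by psi^l into one multiplied by F^l, with the same l. *)
Lemma formal_group_factor : exists U : int * int -> K,
  power_series2 (U : int * int -> K^o) /\ F = smulK U (ssubK (both f) (Fadd K)).
Proof.
have tf := tangent_log; have tg := tangent_log_inverse.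
have [_ _ gf fg] := invf.
have [uA aA] := tangent_fst_unit tangent_Fadd.
set psi := ssubK (both f) (Fadd K).
have powE m : pow2 psi m = ssubK (both f) (pow2 (Fadd K) m).
  by rewrite -pow2_subst_both ?subst_bothE //; exact: tangent_Fadd.
have apsi : admissible (pow2 psi) FL LP.
  rewrite (funext powE); exact: (admissible_comp sLP aA (admissible_both0 tf)).
have upsi : series_unit LP psi.
  exact: (ssubK_unit sLP (admissible_both0 tf) (power_family_both tf)).
have [gps g0 _] := tg.
(* The series g(x) / x, a power series because g(0) = 0; the factor is U = h(psi). *)
pose h n := g (n + 1).
have h0 n : h n != 0 -> 0 <= n.
  rewrite leNgt; apply: contra_neqN => n0; rewrite /h.
  by have [n1|->//] : n + 1 < 0 \/ n + 1 = 0 by [lia]; exact: gps.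
exists (ssubK (pow2 psi) h); split.
  apply/power_series2E => p /(@supp_ssub _ _ _ _ K^o)[m /h0 m0].
  case: m m0 => // n _; apply: (proj1 (@power_series2E K K^o _)).
  exact/power_series2_exp/power_series2_both/power_series2_Fadd.
rewrite smulKC -{1}(pow2_1 psi) -(ssubK_monom (pow2 psi)).
have P1 : series_in FL (monom K (1 : int)) by exists 1 => i /supp_monom ->.
rewrite -(ssubK_mul sLP apsi (power_family_pow2 upsi)) //; last by exists 0.
have -> : smulK (monom K 1) h = g.
  by apply/funext => n; rewrite /smulK smul_monom /h subrK.
rewrite {1}formal_group_conj conj_associateE //; last exact: tangent_Fadd.
have Pg : FL (supp (g : int -> K^o)) by rewrite -(pow1_1 g); exact: pow1_in.
rewrite [LHS](ssubA (W := K^o) aA (admissible_both0 tf) Pg).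
by apply: (@eq_ssub K _ _ _ _ K^o) => m; rewrite powE.
Qed.

End FormalGroupLog.

(** * Transport of nonlocal vertex algebras *)

Section VertexAlgebra.
Variables (K : fieldType) (F : int * int -> K) (f g : int -> K).
Hypotheses (FG : formal_group F) (logF : is_log F f) (invf : comp_inverse f g).

(** Applying T to associativity for the additive group gives the identity for Y_F multiplied by
    (f(x0) + f(x2))^l; multiplication by U^l then gives F^l. *)
Lemma nonlocal_vertex_algebra_subst (V : lmodType K) (Y : V -> V -> int -> V)
    (vac : V) :
  nonlocal_vertex_algebra (Fadd K) Y vac ->
  nonlocal_vertex_algebra F (Ysubst f Y) vac.
Proof.
have tf := tangent_log logF; have tg := tangent_log_inverse logF invf.
have [_ _ gf fg] := invf; have tA := @tangent_Fadd K.
have [f0 _] := power_family_pow1 tf; have [_ fle] := tangent_unit tf.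
case=> Ymap vacl vacr creation assoc; have [Yl Yr YL] := Ymap.
split.
- exact: vertex_map_subst.
- move=> v n; rewrite /Ysubst /subst1 (fsum1 (i := 0)) => [|m m0].
    by rewrite vacl eqxx f0 /sone /monom; case: (n == 0); rewrite ?scale1r ?scale0r.
  by rewrite vacl (negPf m0) scaler0.
- move=> v n n0; rewrite /Ysubst /subst1 fsbig1 // => m _.
  have [m0|m0] := ltP m 0; first by rewrite vacr ?scaler0.
  have [->|/fle] := eqVneq (pow1 f m n) 0; first by rewrite scale0r.
  lia.
- move=> v; rewrite /Ysubst /subst1 (fsum1 (i := 0)) => [|m m0].
    by rewrite creation f0 /sone /monom eqxx scale1r.
  have [m0'|m0'] := ltP m 0; first by rewrite vacr ?scaler0.
  have [->|/fle] := eqVneq (pow1 f m 0) 0; first by rewrite scale0r.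
  lia.
move=> u v w; have [l eql] := assoc u v w; exists l.
have [U [PSU FU]] := formal_group_factor FG logF invf.
have PSA := power_series2_exp l (@power_series2_Fadd K).
pose psi := ssubK (both f) (Fadd K).
have PSpsi : power_series2 (psi : int * int -> K^o).
  exact/power_series2_both/power_series2_Fadd.
have LPpsi := power_series2_LP PSpsi; have LPU := power_series2_LP PSU.
have Fl : sexpn F l = smulK (sexpn U l) (sexpn psi l).
  by rewrite FU (series_expM sLP).
have psil : ssubK (both f) (sexpn (Fadd K) l) = sexpn psi l.
  apply: (ssubK_sexpn l sLP sLP (admissible_both0 tf) (power_family_both tf)).
  exact/power_series2_LP/power_series2_Fadd.
have prodF2 : F2 (supp (Yprod Y u v w)).
  apply: (double_F2 (h := fun m a => Y u a m) (x := Y v w)) => [m||n].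
  - exact: Yr.
  - exact/laurent_seriesE.
  - exact/laurent_seriesE.
have prodE : ssub (both f) (Yprod Y u v w) = Yprod (Ysubst f Y) u v w.
  apply: (both_double (h := fun m a => Y u a m) (x := Y v w) tf) => [m||n].
  - exact: Yr.
  - exact/laurent_seriesE.
  - exact/laurent_seriesE.
pose R (p : int * int) := Y (Y u v p.2) w p.1.
have RF2 : F2 (supp R).
  apply: (double_F2 (h := fun m a => Y a w m) (x := Y u v)) => [m||n].
  - exact: Yl.
  - exact/laurent_seriesE.
  - exact/laurent_seriesE.
have RE : ssub (both f) R = fun p => Ysubst f Y (Ysubst f Y u v p.2) w p.1.
  apply: (both_double (h := fun m a => Y a w m) (x := Y u v) tf) => [m||n].
  - exact: Yl.
  - exact/laurent_seriesE.
  - exact/laurent_seriesE.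
have atE : ssub (both f) (Yprod_at (Fadd K) Y u v w) = Yprod_at F (Ysubst f Y) u v w.
  rewrite !Yprod_atE (both_subst_snd tf tg gf fg tA) // prodE.
  by rewrite -(formal_group_conj FG logF invf).
have atF2 : F2 (supp (Yprod_at (Fadd K) Y u v w)).
  by rewrite Yprod_atE; exact: (sfam_ssub sF2 (admissible_snd_kernel tA)).
(* The series [R] lists the exponent of x2 before that of x0, as its support in F2 requires; [R']
   has the order x0, x2 of the axiom. *)
pose R' (p : int * int) := Ysubst f Y (Ysubst f Y u v p.1) w p.2.
have R'E : ssub (both f) (fun p => Y (Y u v p.1) w p.2) = R'.
  by rewrite -[LHS]/(ssub (both f) (R \o @swap)) ssub_both_swap RE.
have R'F2 : F2 (supp (R' \o @swap)).
  by rewrite -[R' \o _]RE; exact: (sfam_ssub sF2 (admissible_both tf)).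
have PSpl := power_series2_exp l PSpsi; have PSUl := power_series2_exp l PSU.
have key : smul (sexpn psi l) (Yprod_at F (Ysubst f Y) u v w) =
           smul (sexpn psi l) R'.
  have := congr1 (fun a => ssub (both f) a) eql.
  rewrite (ssub_mul sF2 (admissible_both tf) (power_family_both tf)) //; last first.
    exact: power_series2_F2.
  rewrite (both_mul_swap (b := fun p => Y (Y u v p.1) w p.2) tf PSA RF2).
  by rewrite R'E psil atE.
rewrite Fl (sfam_smulA sF2) ?(smulA_swap PSUl PSpl R'F2) ?key //.
- exact: power_series2_F2.
- exact: power_series2_F2.
- by rewrite -atE; exact: (sfam_ssub sF2 (admissible_both tf)).
Qed.

End VertexAlgebra.

(** * Conjugates of associates *)

(** The supports of series in W((x))[[y]][[z]], where both sides of the associate identity are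
    compared. *)
Notation LP3 := (lex0_family (lex0_family bounded_below)).
Definition sLP3 := lex0_family_family (lex0_family_family bounded_below_family).

Section Associates.
Variable K : fieldType.

Lemma monom_in (n : int) : series_in FL (monom K n).
Proof. by exists n => i /supp_monom ->. Qed.

Lemma power_family_monom : power_family (@monom K int).
Proof. by split=> // k l; exact: smul_monomD. Qed.

Lemma locally_finite_monom (I : zmodType) (D : set I) :
  locally_finite (@monom K I) D.
Proof.
move=> i; apply: (@sub_finite_set _ _ [set i]); last exact: finite_set1.
by move=> m [_ /supp_monom ->].
Qed.

Definition assoc3 (p : int * int * int) : int * (int * int) :=
  (p.1.1, (p.1.2, p.2)).

Lemma assoc3_bij : bijective assoc3.
Proof. by exists (fun q => (q.1, q.2.1, q.2.2)) => [[[]]|[? []]]. Qed.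

(* The variables of the coefficients are x, y, z in this order: [left_kernel phi]
   sends x^m z^n to phi(x, y)^m z^n, and [right_kernel F] sends it to
   x^m F(y, z)^n. *)
Definition left_kernel (phi : int * int -> K) :
    int * int -> int * int * int -> K :=
  tens (pow2 phi) (@monom K int).

Definition right_kernel (F : int * int -> K) :
    int * int -> int * int * int -> K :=
  fun q => tens (@monom K int) (pow2 F) q \o assoc3.

Lemma ssub_left_kernel (phi a : int * int -> K) i j k :
  ssubK (left_kernel phi) a (i, j, k) =
  \sum_(n \in [set: int]) a (n, k) * pow2 phi n (i, j).
Proof.
rewrite /ssubK /ssub (fsum_fst (c := k)) => [|[n l] /= lk].
  apply: eq_fsbigr => n _.
  by rewrite /left_kernel /tens /monom /= eqxx mulr1; exact: mulrC.
by rewrite /left_kernel /tens /monom /= eq_sym (negPf lk) mulr0 scale0r.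
Qed.

Lemma ssub_right_kernel (F a : int * int -> K) i j k :
  ssubK (right_kernel F) a (i, j, k) =
  \sum_(n \in [set: int]) a (i, n) * pow2 F n (j, k).
Proof.
rewrite /ssubK /ssub (fsum_snd (c := i)) => [|[n l] /= lk].
  apply: eq_fsbigr => n _.
  by rewrite /right_kernel /tens /monom /= eqxx mul1r; exact: mulrC.
by rewrite /right_kernel /tens /monom /= eq_sym (negPf lk) mul0r scale0r.
Qed.

Lemma associateE (F phi : int * int -> K) :
  associate F phi <->
  tangent_to_fst phi /\ ssubK (left_kernel phi) phi = ssubK (right_kernel F) phi.
Proof.
split=> [[phi_lp phi1 e]|[[phi_lp phi1] e]].
  split=> //; apply/funext => -[[i j] k].
  by rewrite ssub_left_kernel ssub_right_kernel.
split=> // i j k; have := congr1 (@^~ (i, j, k)) e.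
by rewrite ssub_left_kernel ssub_right_kernel.
Qed.

Section LeftKernel.
Variable phi : int * int -> K.
Hypothesis tphi : tangent_to_fst phi.
Let uphi : series_unit LP phi := (tangent_fst_unit tphi).1.
Let aphi : admissible (pow2 phi) FL LP := (tangent_fst_unit tphi).2.

Lemma admissible_left_kernel : admissible (left_kernel phi) LP LP3.
Proof.
by apply: (admissible_tens0 sLP aphi) => n b /supp_monom ->.
Qed.

Lemma power_family_left_kernel : power_family (left_kernel phi).
Proof.
apply: (power_family_tens sLP sFL) => [m|n||].
- exact: pow2_in.
- exact: monom_in.
- exact: power_family_pow2.
- exact: power_family_monom.
Qed.

End LeftKernel.

Section RightKernel.
Variable F : int * int -> K.
Hypotheses (PSF : power_series2 (F : int * int -> K^o)) (tF : tangent_to_fst F).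
Let uF : series_unit LP F := (tangent_fst_unit tF).1.

(** F is a power series without constant term, so every term of F^n has total degree at least n. *)
Lemma pow2_degree (n i j : int) : 0 <= n -> pow2 F n (i, j) != 0 ->
  [/\ 0 <= i, 0 <= j & n <= i + j].
Proof.
case: n => // n _; elim: n i j => [|n IHn] i j; first by move=> /supp_monom [-> ->].
move=> /supp_smul[[k l] Fkl /IHn[/= ik jl nkl]].
have [/= k0 l0] := proj1 (@power_series2E K K^o F) PSF _ Fkl.
suff : 1 <= k + l by split; lia.
have [_ F1] := tF.
suff : ~ (k = 0 /\ l = 0) by lia.
by move=> [k0' l0']; move: Fkl; rewrite k0' l0' /supp /= F1 /monom eqxx.
Qed.

(** Exponents n of z are nonnegative on the source, and the coefficient of y^j z^k sees only n <= j
    + k by [pow2_degree]. *)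
Lemma admissible_right_kernel : admissible (right_kernel F) LP LP3.
Proof.
move=> D [D0 Dn].
have key m n i j k : D (m, n) -> right_kernel F (m, n) (i, j, k) != 0 ->
    [/\ i = m, 0 <= n <= j + k, 0 <= j & 0 <= k].
  move=> Dmn; rewrite mulf_eq0 negb_or => /andP[/supp_monom /= -> Fn].
  have n0 := D0 _ Dmn; have [j0 k0 njk] := pow2_degree n0 Fn.
  by split=> //; apply/andP.
split.
  split=> [[[i j] k] [[m n] Dmn /(key _ _ _ _ _ Dmn)[]]//|k].
  split=> [[i j] [[m n] Dmn /(key _ _ _ _ _ Dmn)[]]//|j].
  apply: (sfamS sFL _ (sfam_bigcup sFL (finite_int_interval 0 (j + k))
    (G := fun n => [set i | D (i, n)]) _)) => // i.
  move=> [[m n] Dmn /(key _ _ _ _ _ Dmn)[-> njk _ _]].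
  by exists n.
move=> [[i j] k].
apply: sub_finite_set (finite_image (pair i) (finite_int_interval 0 (j + k))).
by move=> [m n] [Dmn /(key _ _ _ _ _ Dmn)[-> njk _ _]]; exists n.
Qed.

Lemma power_family_right_kernel : power_family (right_kernel F).
Proof.
have [t0 tD] : power_family (tens (@monom K int) (pow2 F)).
  apply: (power_family_tens sFL sLP) => [m|n||].
  - exact: monom_in.
  - exact: pow2_in.
  - exact: power_family_monom.
  - exact: power_family_pow2.
split.
  apply/funext => -[[i j] k]; rewrite /right_kernel t0 /sone /monom /=.
  by rewrite /assoc3 /= !xpair_eqE andbA.
move=> q r; rewrite /right_kernel tD.
by apply/esym/(@smul_reindex K _ _ assoc3 K^o) => //; exact: assoc3_bij.
Qed.

End RightKernel.

Section Conjugation.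
Variables (F phi : int * int -> K) (f g : int -> K).
Hypotheses (FG : formal_group F) (logF : is_log F f) (invf : comp_inverse f g).
Hypothesis tphi : tangent_to_fst phi.
Local Notation phibar := (conj_associate f g phi).

Let tf : tangent_to_id f := tangent_log logF.
Let tg : tangent_to_id g := tangent_log_inverse logF invf.
Let gf : subst1K f g = monom K 1. Proof. by case: invf. Qed.
Let fg : subst1K g f = monom K 1. Proof. by case: invf. Qed.
Let tbar : tangent_to_fst phibar := conj_tangent tf tg gf tphi.
Let tF : tangent_to_fst F := tangent_formal_group FG.

Definition triple : int * int * int -> int * int * int -> K :=
  tens (both f) (pow1 f).

Lemma admissible_triple : admissible triple LP3 LP3.
Proof.
apply: (admissible_tens0 sLP (admissible_both0 tf)) => n b.
by case: (tangent_unit tf) => _; apply.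
Qed.

(** Both sides are f(phibar(x, y))^m f(z)^n; the analogue for the right kernel has f(x)^m f(F(y,
    z))^n. *)
Lemma triple_left_kernel q :
  ssubK triple (left_kernel phi q) = ssubK (left_kernel phibar) (both f q).
Proof.
have [uphi _] := tangent_fst_unit tphi.
case: q => m n; rewrite [LHS]ssubK_tens; first last.
- by have [] := admissible_pow1 tf (monom_in n).
- by have [] := admissible_both0 tf (pow2_in m uphi).
rewrite [RHS]ssubK_tens; first last.
- exact: locally_finite_monom.
- by have [_] := tangent_fst_unit tbar => /(_ _ (pow1_in m tf))[].
rewrite (ssub_pow2_conj tf tg fg tphi) ssubK_monom.
by rewrite [ssubK (@monom K int) _](@ssub_id K int K^o).
Qed.

Lemma triple_right_kernel q :
  ssubK triple (right_kernel (Fadd K) q) = ssubK (right_kernel F) (both f q).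
Proof.
have tA := @tangent_Fadd K; have [uA _] := tangent_fst_unit tA.
case: q => m n; apply/funext => p.
transitivity (ssubK (tens (pow1 f) (both f))
    (fun q => monom K m q.1 * pow2 (Fadd K) n q.2) (assoc3 p)).
  rewrite /ssubK /ssub [RHS](@reindex_fsbigT _ _ _ _ _ assoc3 _ assoc3_bij).
  by apply: eq_fsbigr => i _; rewrite /triple /both /tens /= mulrA.
rewrite ssubK_tens; first last.
- by have [] := admissible_both0 tf (pow2_in n uA).
- by have [] := admissible_pow1 tf (monom_in m).
rewrite -[RHS]/(ssubK (tens (@monom K int) (pow2 F))
    (fun p => pow1 f m p.1 * pow1 f n p.2) (assoc3 p)).
rewrite [in RHS]ssubK_tens; first last.
- by have [_] := tangent_fst_unit tF => /(_ _ (pow1_in n tf))[].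
- exact: locally_finite_monom.
rewrite ssubK_monom [ssubK (@monom K int) _](@ssub_id K int K^o).
by rewrite {1}(formal_group_conj FG logF invf) (ssub_pow2_conj tf tg fg tA).
Qed.

(** For h = g(phi), the identity h(phi(x, y), z) = h(x, y + z) is obtained first; substituting f in
    all three variables turns it into the identity for phibar = T(h). *)
Lemma associate_conj : associate (Fadd K) phi -> associate F phibar.
Proof.
move=> /associateE[_ eLR]; apply/associateE; split=> //.
have [uphi aphi] := tangent_fst_unit tphi.
have tA := @tangent_Fadd K; have PSA := @power_series2_Fadd K.
have PSF := power_series2_formal_group FG.
have aL := admissible_left_kernel tphi; have pL := power_family_left_kernel tphi.
have aR := admissible_right_kernel PSA tA; have pR := power_family_right_kernel tA.
have aL' := admissible_left_kernel tbar; have aR' := admissible_right_kernel PSF tF.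
have Pg : FL (supp (g : int -> K^o)) by rewrite -(pow1_1 g); exact: pow1_in.
set h := ssubK (pow2 phi) g.
have Ph : LP (supp (h : int * int -> K^o)) by exact: (series_ssub sLP aphi).
(* Both kernels are multiplicative, so the identity for phi passes to every phi^m and then to the
   combination g(phi). *)
have eh : ssubK (left_kernel phi) h = ssubK (right_kernel (Fadd K)) h.
  rewrite [LHS](ssubA (W := K^o) aphi aL Pg) [RHS](ssubA (W := K^o) aphi aR Pg).
  apply: (@eq_ssub K _ _ _ _ K^o) => m; rewrite pow2E.
  by rewrite (ssubK_sexpz sLP3 aL sLP pL) // eLR -(ssubK_sexpz sLP3 aR sLP pR).
have e : phibar = ssubK (both f) h := conj_associateE tf tg tphi.
transitivity (ssubK (left_kernel phibar) (ssubK (both f) h)).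
  by congr (ssubK _ _).
transitivity (ssubK (right_kernel F) (ssubK (both f) h)); last first.
  by congr (ssubK _ _).
rewrite [LHS](ssubA (W := K^o) (admissible_both0 tf) aL' Ph).
rewrite [RHS](ssubA (W := K^o) (admissible_both0 tf) aR' Ph).
rewrite -(eq_ssub (h : int * int -> K^o) triple_left_kernel).
rewrite -(eq_ssub (h : int * int -> K^o) triple_right_kernel).
rewrite -[LHS](ssubA (W := K^o) aL admissible_triple Ph).
rewrite -[RHS](ssubA (W := K^o) aR admissible_triple Ph).
by rewrite -!/(ssubK _ h) eh.
Qed.

End Conjugation.

End Associates.

Theorem corollary4p5 (R : realType) (V : lmodType R[i])
    (Y : V -> V -> int -> V) (vac : V)
    (F : int * int -> R[i]) (f g : int -> R[i]) (phi : int * int -> R[i]) :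
  nonlocal_vertex_algebra (Fadd R[i]) Y vac ->
  formal_group F -> is_log F f -> comp_inverse f g ->
  associate (Fadd R[i]) phi ->
  let phibar := conj_associate f g phi in
  let YF := Ysubst f Y in
  [/\ associate F phibar,
      nonlocal_vertex_algebra F YF vac,
      subst_isomorphism diff_powers vac f phi phibar Y YF &
      subst_isomorphism all_series vac f phi phibar Y YF].
Proof.
move=> nlva FG logF invf phiA phibar YF.
have tf := tangent_log logF; have tg := tangent_log_inverse logF invf.
have [_ _ gf fg] := invf; have Ymap := nlva_map nlva.
have tphi : tangent_to_fst phi by case: phiA.
split.
- exact: associate_conj.
- exact: (nonlocal_vertex_algebra_subst FG logF invf).
- apply: (subst_isomorphismP tf tg gf fg tphi vac _ _ Ymap).
    exact: (diff_powers_stable tf tg gf).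
  exact: (diff_powers_stable tg tf fg).
- apply: (subst_isomorphismP tf tg gf fg tphi vac _ _ Ymap).
    exact: all_series_stable.
  exact: all_series_stable.
Qed.
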